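(* There is an absolute constant $c>0$ such that for every $n$ and every centrally symmetric convex set $K\subseteq\mathbb{R}^n$, viewing $K$ as the function $K:\mathbb{R}^n\to\{-1,1\}$, we have $\mathsf{W}^{=0}[K]+\mathsf{W}^{=2}[K]\ge c/n$.
   Context: $K(x)=1$ if $x\in K$ and $-1$ otherwise. For $S\in\mathbb{N}^n$ let $H_S(x)=\prod_i h_{S_i}(x_i)$ where $h_0,h_1,\dots$ are the normalized univariate Hermite polynomials ($h_0=1$, $h_1(x)=x$, $h_2(x)=(x^2-1)/\sqrt2,\dots$), orthonormal under $N(0,1)$. The Hermite coefficients are $\tilde f(S)=\mathbf{E}_{\mathbf{g}\sim N(0,I_n)}[f(\mathbf{g})H_S(\mathbf{g})]$, $|S|=\sum_i S_i$, $\mathsf{W}^{=j}[f]=\sum_{|S|=j}\tilde f(S)^2$ and $\mathsf{W}^{\le j}[f]=\sum_{|S|\le j}\tilde f(S)^2$. A set is centrally symmetric if $x\in K\iff -x\in K$. *)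

(* Defs.v *)
From HB Require Import structures.
From mathcomp Require Import all_boot all_order all_algebra.
From mathcomp Require Import all_classical all_reals all_analysis.
Set Implicit Arguments. Unset Strict Implicit. Unset Printing Implicit Defensive.
Import Order.TTheory GRing.Theory Num.Theory.
Local Open Scope classical_set_scope.
Local Open Scope ring_scope.

Section Defs.
Variable R : realType.

(* Probabilists' Hermite polynomials He_k, via He_{k+1} = x He_k - k He_{k-1}. *)
Fixpoint hermite_pair (k : nat) (x : R) : R * R :=
  match k with
  | 0 => (1, x)
  | k'.+1 => let p := hermite_pair k' x in
             (p.2, x * p.2 - k'.+1%:R * p.1)
  end.

Definition He (k : nat) (x : R) : R := (hermite_pair k x).1.

(* normalized Hermite polynomials, orthonormal under N(0,1) *)
Definition hermite (k : nat) (x : R) : R := He k x / Num.sqrt (k`!)%:R.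

Definition hermiteS (n : nat) (S : 'I_n -> nat) (x : 'rV[R]_n) : R :=
  \prod_(i < n) hermite (S i) (x ord0 i).

Fixpoint gauss_expect (n : nat) : ('rV[R]_n -> R) -> R :=
  match n return ('rV[R]_n -> R) -> R with
  | 0 => fun f => f 0
  | n'.+1 => fun f =>
      Rintegral lebesgue_measure setT
        (fun t : R => normal_pdf 0 1 t *
           gauss_expect (fun v : 'rV[R]_n' => f (row_mx (\row_(j < 1) t) v)))
  end.

Definition hermite_coef (n : nat) (f : 'rV[R]_n -> R) (S : 'I_n -> nat) : R :=
  gauss_expect (fun x => f x * hermiteS S x).

(* W^{=j}[f] = sum_{|S| = j} f~(S)^2 ; multi-indices with |S| = j have all
   entries <= j, so they are enumerated as S : {ffun 'I_n -> 'I_j.+1}. *)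
Definition weight_eq (n : nat) (f : 'rV[R]_n -> R) (j : nat) : R :=
  \sum_(S : {ffun 'I_n -> 'I_j.+1} | (\sum_(i < n) (S i : nat))%N == j)
     hermite_coef f (fun i => (S i : nat)) ^+ 2.

Definition set_sign (n : nat) (K : set 'rV[R]_n) (x : 'rV[R]_n) : R :=
  if `[< K x >] then 1 else -1.

Definition centrally_symmetric (n : nat) (K : set 'rV[R]_n) : Prop :=
  forall x : 'rV[R]_n, K x <-> K (- x).

End Defs.

(* Main.v *)
Require Import Defs.
From HB Require Import structures.
From mathcomp Require Import all_boot all_order all_algebra.
From mathcomp Require Import all_classical all_reals all_analysis.
From mathcomp Require Import measurable_realfun ring lra.
Import Order.TTheory GRing.Theory Num.Theory.
Import numFieldNormedType.Exports.
Local Open Scope classical_set_scope.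
Local Open Scope ring_scope.

(** Let [g] be the Gaussian measure, [C] the closure of [K] (whose iterated
    integrals are those of [K]), and [A = n g(C) - int_C |x|^2], the derivative
    at [l = 1] of [l |-> g(l C)].  The degree-0 weight is [(2 g(C) - 1)^2], and
    the coefficients at the multi-indices [2 e_i] add up to [- sqrt 2 A], so by
    Cauchy-Schwarz the degree-2 weight is at least [2 A^2 / n].  It remains to
    bound [A] below by an absolute constant when [g(C)] is in [[2/5, 3/5]].

    For independent Gaussians [x, y], rotating [x] into [y] by repeatedly halved
    angles gives [P(x \in C, c x + s y \notin C) >= const * s / c] for [s / c]
    small.  Undoing the rotation, this is the event [c z - s y \in C, z \notin C],
    which for [y \in t C] forces [z \in ((1 + s t) / c) C \ C], of measure about
    [A t s / c].  As [g(t C)] tends to 1 fast (Fernique), averaging over the gauge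
    of [y] yields the lower bound on [A]. *)

(** * Gaussian measure on row vectors *)

(** A convex set may contain an arbitrary part of its boundary, so [K] need not be Borel, while
    [gauss_expect] integrates its indicator one coordinate at a time. Passing to the closure is
    harmless because, at each level of the iteration, closing and slicing commute for all but two
    values of the coordinate.

    A bound on [A] free of [n] cannot be read off the expansion of [g((1 + e) C)], whose remainder
    is only controlled by a multiple of [n^2 e^2]. Noise sensitivity supplies it: doubling the angle
    at most doubles the exit probability, so the value at a quarter turn passes to arbitrarily small
    angles with no loss in the rate, and there the remainder disappears. The dimension then enters
    only through Cauchy-Schwarz over the [n] coordinates.

    The dilation needed for a given [y] grows with its gauge, so the tails of the gauge must decay
    faster than the squared radii grow; Fernique's argument gives this from [g(C)] alone. All limits
    are taken along powers of [1/2] in explicit inequalities, and angles are represented by pairs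
    [c, s] with [c^2 + s^2 = 1]. *)

Definition rv_display : measure_display. Proof. exact: default_measure_display. Qed.

(** Generators of the product sigma-algebra, chosen so that a map into row vectors is measurable as
    soon as its coordinates are. *)
Definition cylinder (R : realType) (n : nat) : set (set 'rV[R]_n) :=
  [set A | exists i (B : set R), measurable B /\ A = [set x : 'rV[R]_n | B (x ord0 i)]].
Arguments cylinder {R n}.

Section rv_measurable.
Context {R : realType} {n : nat}.

Let rv_set0 : <<s (@cylinder R n) >> set0.
Proof. exact: (@sigma_algebra0 _ setT cylinder). Qed.

Let rv_setC A : <<s (@cylinder R n) >> A -> <<s cylinder >> (~` A).
Proof. by move=> h; rewrite -setTD; exact: sigma_algebraCD. Qed.

Let rv_bigcup (F : _^nat) : (forall i, <<s (@cylinder R n) >> (F i)) ->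
  <<s cylinder >> (\bigcup_i (F i)).
Proof. exact: (@sigma_algebra_bigcup _ setT cylinder). Qed.

HB.instance Definition _ := @isMeasurable.Build rv_display
  'rV[R]_n <<s cylinder >> rv_set0 rv_setC rv_bigcup.

Lemma measurable_coord (i : 'I_n) :
  measurable_fun [set: 'rV[R]_n] (fun x : 'rV[R]_n => x ord0 i).
Proof.
move=> _ Y mY; rewrite setTI; apply: sub_sigma_algebra.
by exists i, Y.
Qed.

Lemma measurable_fun_rVP d (T : measurableType d) (f : T -> 'rV[R]_n) :
  (forall i, measurable_fun setT (fun t => f t ord0 i)) -> measurable_fun setT f.
Proof.
move=> mf; apply: (@measurability _ _ _ _ _ _ (@cylinder R n)) => //.
move=> _ [_ [i [B [mB ->]]] <-].
exact: mf.
Qed.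

End rv_measurable.


(** Same shape as the argument built inside [gauss_expect], so that unfolding one level of the
    latter produces slices along [rvcons]. *)
Definition rvcons {R : realType} (n : nat) (p : R * 'rV[R]_n) : 'rV[R]_n.+1 :=
  row_mx (\row_(j < 1) p.1) p.2.
Arguments rvcons {R n}.

Section rv_maps.
Context {R : realType}.

Lemma rvcons0 n (p : R * 'rV[R]_n) : rvcons p ord0 ord0 = p.1.
Proof.
rewrite /rvcons.
have -> : (ord0 : 'I_n.+1) = @lshift 1 n ord0 by apply: val_inj.
by rewrite (@row_mxEl _ 1 1 n) mxE.
Qed.

Lemma rvconsS n (p : R * 'rV[R]_n) j : rvcons p ord0 (lift ord0 j) = p.2 ord0 j.
Proof.
rewrite /rvcons.
have -> : (lift ord0 j : 'I_n.+1) = @rshift 1 n j by apply: val_inj.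
by rewrite (@row_mxEr _ 1 1 n).
Qed.

Lemma rvcons_inj n (x : 'rV[R]_n.+1) : exists p, x = rvcons p.
Proof.
exists (x ord0 ord0, \row_j x ord0 (lift ord0 j)).
apply/rowP => i; case: (unliftP ord0 i) => [j|] ->.
  by rewrite rvconsS mxE.
by rewrite rvcons0.
Qed.

Lemma measurable_rvcons n : measurable_fun setT (@rvcons R n).
Proof.
apply: measurable_fun_rVP => i.
case: (unliftP ord0 i) => [j|] ->.
  under eq_fun do rewrite rvconsS.
  exact: (measurableT_comp (measurable_coord j) measurable_snd).
under eq_fun do rewrite rvcons0; exact: measurable_fst.
Qed.

HB.instance Definition _ n :=
  @isMeasurableFun.Build _ _ _ _ (@rvcons R n) (@measurable_rvcons n).

Lemma measurable_rvD d (T : measurableType d) n (f g : T -> 'rV[R]_n) :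
  measurable_fun setT f -> measurable_fun setT g ->
  measurable_fun setT (fun t => f t + g t).
Proof.
move=> mf mg; apply: measurable_fun_rVP => i.
under eq_fun do rewrite mxE.
by apply: measurable_funD; exact: (measurableT_comp (measurable_coord i)).
Qed.

Lemma measurable_rvZ d (T : measurableType d) n (c : R) (f : T -> 'rV[R]_n) :
  measurable_fun setT f -> measurable_fun setT (fun t => c *: f t).
Proof.
move=> mf; apply: measurable_fun_rVP => i.
under eq_fun do rewrite mxE.
by apply: measurable_funM => //; exact: (measurableT_comp (measurable_coord i)).
Qed.

End rv_maps.

(** * The standard Gaussian measure and its density *)

Section gauss.
Context {R : realType}.


Let idTR : measurableTypeR R -> R := idfun.

#[local] HB.instance Definition _ :=
  @isMeasurableFun.Build _ _ _ _ idTR (@measurable_id _ _ setT).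

Definition std : probability R R := distribution (normal_prob (0:R) 1) idTR.

(** The recursion follows that of [gauss_expect], one coordinate split off at a time; this makes the
    two comparable by induction. *)
Fixpoint gauss (n : nat) : probability 'rV[R]_n R :=
  match n return probability 'rV[R]_n R with
  | 0 => \d_(0 : 'rV[R]_0)
  | n'.+1 => distribution (std \x gauss n')%E (@rvcons R n')
  end.

Local Open Scope ereal_scope.
Local Notation leb := (@lebesgue_measure R).
Local Notation pdf := (normal_pdf (0:R) 1).

Lemma ge0_integral_std (f : R -> \bar R) : measurable_fun setT f ->
  (forall x, 0 <= f x) -> \int[std]_x f x = \int[leb]_x (f x * (pdf x)%:E).
Proof.
move=> mf f0.
rewrite [LHS]ge0_integral_distribution//=.
have dom := @normal_prob_dominates R 0 1.
rewrite -(Radon_Nikodym_SigmaFinite.change_of_variables dom)//.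
apply: ae_eq_integral => //.
- apply: emeasurable_funM => //.
  exact: measurable_int (Radon_Nikodym_SigmaFinite.f_integrable dom).
- apply: emeasurable_funM => //.
  by apply/measurable_EFinP; exact: measurable_normal_pdf.
(* Uniqueness of densities: both functions have the same integral over every measurable set. *)
- have : ae_eq leb setT (Radon_Nikodym_SigmaFinite.f (normal_prob (0:R) 1) leb)
    (EFin \o pdf).
    apply: integral_ae_eq => //.
    + exact: Radon_Nikodym_SigmaFinite.f_integrable.
    + by apply/measurable_EFinP; exact: measurable_normal_pdf.
    + by move=> E _ mE; rewrite -Radon_Nikodym_SigmaFinite.f_integral.
  by apply: filterS => x /= + _ => /(_ I) ->.
Qed.

End gauss.

(** * Dilations and rotations as changes of variables *)

Section affine.
Context {R : realType}.
Local Open Scope ereal_scope.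
Local Notation leb := (@lebesgue_measure R).
Local Notation pdf := (normal_pdf (0:R) 1).

Definition affine (a b : R) : measurableTypeR R -> measurableTypeR R :=
  fun x => (a * x + b)%R.

Lemma measurable_affine (a b : R) : measurable_fun setT (affine a b).
Proof.
apply: (@measurable_funD _ _ R) => //; apply: (@measurable_funM _ _ R) => //; exact: measurable_id.
Qed.

Let pushforward_affine (a b : R) : {measure set (measurableTypeR R) -> \bar R} :=
  measure_function_pushforward__canonical__measure_function_Measure
    leb (measurable_affine a b).

Lemma lebesgue_measure_affine (a b : R) (A : set (measurableTypeR R)) :
  (0 < a)%R -> measurable A ->
  leb A = a%:E * leb (affine a b @^-1` A).
Proof.
move=> a0 mA.
have a0' : (0 <= a)%R by exact: ltW.
(* Uniqueness of Lebesgue measure: the rescaled pushforward also gives each []u, v]] its length. *)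
pose nu := mscale (NngNum a0') (pushforward_affine a b).
rewrite (@lebesgue_measure_unique R nu)// => _ [[u v] /= uv <-].
rewrite /nu /mscale/= /pushforward.
have -> : affine a b @^-1` `]u, v] =
   `]((u - b) / a)%R, ((v - b) / a)%R]%classic.
  by apply/seteqP; split => x /=; rewrite !in_itv/= ltr_pdivrMr// ler_pdivlMr//
    ltrBlDr lerBrDr mulrC.
rewrite !lebesgue_measure_itv/= !lte_fin ltr_pM2r ?invr_gt0// ltrD2r.
case: ifPn => // _; last by rewrite mule0.
rewrite -!EFinD -EFinM; congr EFin.
by rewrite -mulrBl mulrC divfK ?gt_eqF//; ring.
Qed.

Lemma ge0_integral_affine (a b : R) (f : R -> \bar R) : (0 < a)%R ->
  measurable_fun setT f -> (forall x, 0 <= f x) ->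
  \int[leb]_x f x = \int[leb]_x (a%:E * f (a * x + b)%R).
Proof.
move=> a0 mf f0.
have a0' : (0 <= a)%R by exact: ltW.
rewrite ge0_integralZl//; last first.
  exact: (measurableT_comp mf (measurable_affine a b)).
have -> : \int[leb]_x f x =
   \int[mscale (NngNum a0') (pushforward_affine a b)]_x f x.
  apply: eq_measure_integral => A mA _.
  exact: lebesgue_measure_affine.
rewrite ge0_integral_mscale//; congr (_ * _).
exact: (ge0_integral_pushforward (measurable_affine a b)).
Qed.

Lemma normal_pdf01E (x : R) :
  pdf x = (normal_peak 1 * expR (- (x ^+ 2 / 2)))%R.
Proof.
by rewrite normal_pdfE ?oner_eq0// /normal_fun subr0 expr1n mulNr.
Qed.

Lemma measurable_pdf : measurable_fun [set: R] (fun x : R => (pdf x)%:E).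
Proof. by apply/measurable_EFinP; exact: measurable_normal_pdf. Qed.

(** The exponential is the density of [N(0, l^2)] relative to [N(0, 1)]. Keeping [ln l] in the
    exponent turns products over coordinates into sums and prepares for [exp v >= 1 + v]. *)
Lemma std_dilation (l : R) (f : R -> \bar R) : (0 < l)%R ->
  measurable_fun setT f -> (forall x, 0 <= f x) ->
  \int[std]_x f x =
  \int[std]_x (f (l^-1 * x)%R * (expR ((1 - l ^- 2) / 2 * x ^+ 2 - ln l))%:E).
Proof.
move=> l0 mf f0.
have mfl : measurable_fun [set: R] (fun x : R => f (l^-1 * x)%R).
  by apply: (measurableT_comp mf); exact: measurable_funM.
have me : measurable_fun [set: R]
    (fun x : R => (expR ((1 - l ^- 2) / 2 * x ^+ 2 - ln l))%:E).
  apply/measurable_EFinP; apply: measurableT_comp => //.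
  by apply: measurable_funB => //; apply: measurable_funM => //; exact: measurable_funX.
rewrite !ge0_integral_std//; last 2 first.
  exact: emeasurable_funM.
  by move=> x; rewrite mule_ge0// lee_fin expR_ge0.
rewrite (@ge0_integral_affine l^-1 0); first last.
- by move=> x; rewrite mule_ge0// lee_fin normal_pdf_ge0.
- by apply: emeasurable_funM => //; exact: measurable_pdf.
- by rewrite invr_gt0.
apply: eq_integral => x _.
rewrite addr0 muleCA -!muleA; congr (_ * _).
rewrite -!EFinM; congr EFin.
rewrite !normal_pdf01E.
transitivity (normal_peak 1 * (expR (- ln l) * expR (- ((l^-1 * x) ^+ 2 / 2))))%R.
  by rewrite (expRN (ln l)) lnK ?posrE// mulrCA.
rewrite -expRD [RHS]mulrCA -expRD; congr (_ * expR _)%R.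
field; by rewrite gt_eqF.
Qed.

(** The product density depends only on [x^2 + y^2], and a rotation with [0 < c] factors into two
    one-variable affine substitutions, separated by an exchange of the integrals. *)
Lemma std_rotation (c s : R) (F : R * R -> \bar R) : (0 < c)%R -> (c ^+ 2 + s ^+ 2 = 1)%R ->
  measurable_fun setT F -> (forall x, 0 <= F x) ->
  \int[std]_x \int[std]_y F (x, y) =
  \int[std]_x \int[std]_y F (c * x + s * y, c * y - s * x)%R.
Proof.
move=> c0 cs mF F0.
have cn0 : c != 0%R by rewrite gt_eqF.
pose G (p : R * R) := F p * (pdf p.1 * pdf p.2)%:E.
have mG : measurable_fun setT G.
  apply: emeasurable_funM => //; apply/measurable_EFinP.
  by apply: measurable_funM; apply: measurableT_comp => //; exact: measurable_normal_pdf.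
have G0 p : 0 <= G p by rewrite mule_ge0// lee_fin mulr_ge0// normal_pdf_ge0.
have toG (H : R * R -> \bar R) : measurable_fun setT H -> (forall x, 0 <= H x) ->
   \int[std]_x \int[std]_y H (x, y) =
   \int[leb]_x \int[leb]_y (H (x, y) * (pdf x * pdf y)%:E).
  move=> mH H0.
  have mHi : measurable_fun setT (fun x => \int[std]_y H (x, y)).
    exact: (measurable_fun_fubini_tonelli_F H).
  rewrite ge0_integral_std//; last by move=> x; exact: integral_ge0.
  apply: eq_integral => x _.
  have mHx : measurable_fun setT (fun y => H (x, y)).
    exact: (measurableT_comp mH (pair1_measurable x)).
  rewrite ge0_integral_std// -ge0_integralZr//.
  - apply: eq_integral => y _.
    by rewrite EFinM -muleA [(pdf x)%:E * _]muleC.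
  - by apply: emeasurable_funM => //; exact: measurable_pdf.
  - by move=> y _; rewrite mule_ge0// lee_fin normal_pdf_ge0.
  - by rewrite lee_fin normal_pdf_ge0.
rewrite toG//.
have mrot : measurable_fun [set: R * R] (fun p : R * R => (c * p.1 + s * p.2, c * p.2 - s * p.1)%R).
  apply/measurable_fun_pairP; split => /=.
    by apply: measurable_funD; exact: measurable_funM.
  by apply: measurable_funB; exact: measurable_funM.
pose F' (p : R * R) := F (c * p.1 + s * p.2, c * p.2 - s * p.1)%R.
have mF' : measurable_fun setT F' by exact: (measurableT_comp mF mrot).
have F'0 p : 0 <= F' p by exact: F0.
rewrite -[RHS]/(\int[std]_x \int[std]_y F' (x, y)) [RHS](toG F' mF' F'0).
have Grot x y : F' (x, y) * (pdf x * pdf y)%:E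
   = G (c * x + s * y, c * y - s * x)%R.
  rewrite /G /F'/=; congr (_ * _%:E); rewrite !normal_pdf01E.
  rewrite mulrACA [RHS]mulrACA -!expRD; congr (_ * expR _)%R.
  have -> : (- ((c * x + s * y) ^+ 2 / 2) - (c * y - s * x) ^+ 2 / 2 =
     - ((c ^+ 2 + s ^+ 2) * ((x ^+ 2 + y ^+ 2) / 2)))%R by field.
  by rewrite cs; field.
under [RHS]eq_integral do under eq_integral do rewrite Grot.
rewrite -[LHS]/(\int[leb]_x \int[leb]_y G (x, y)).
(* substitute [x = (u + s y) / c], then [y = c v - s u] *)
have mG1 (y : R) : measurable_fun setT (fun x => G (x, y)).
  exact: (measurableT_comp mG (pair2_measurable y)).
have mG2 (x : R) : measurable_fun setT (fun y => G (x, y)).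
  exact: (measurableT_comp mG (pair1_measurable x)).
transitivity (\int[leb]_y \int[leb]_u (c^-1%:E * G (c^-1 * u + s * y / c, y)%R)).
  rewrite (@fubini_tonelli _ _ (measurableTypeR R) (measurableTypeR R) R leb leb G mG G0); apply: eq_integral => y _.
  apply: (@ge0_integral_affine c^-1 (s * y / c)%R (fun x => G (x, y))) => //.
  by rewrite invr_gt0.
transitivity (\int[leb]_y \int[leb]_u (c^-1%:E * G (c^-1 * (u + s * y), y)%R)).
  apply: eq_integral => y _; apply: eq_integral => u _; congr (_ * G (_, _)).
  by field.
pose H (p : R * R) := c^-1%:E * G (c^-1 * (p.2 + s * p.1), p.1)%R.
have mH : measurable_fun setT H.
  apply: emeasurable_funM => //; apply: (measurableT_comp mG).
  apply/measurable_fun_pairP; split; last exact: measurable_fst.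
  apply: (@measurable_funM _ _ R) => //=.
  by apply: measurable_funD => //; exact: measurable_funM.
have H0 p : 0 <= H p by rewrite mule_ge0// lee_fin invr_ge0 ltW.
rewrite -[LHS]/(\int[leb]_y \int[leb]_u H (y, u)) (@fubini_tonelli _ _ (measurableTypeR R) (measurableTypeR R) R leb leb H mH H0).
apply: eq_integral => u _.
rewrite (@ge0_integral_affine c (- (s * u))%R (fun y => H (y, u)))//; last first.
  exact: (measurableT_comp mH (pair2_measurable u)).
apply: eq_integral => v _; rewrite /H/= muleA -EFinM divff// mul1e.
have -> : (c^-1 * (u + s * (c * v + - (s * u))) = c * u + s * v)%R.
  have s2 : (s ^+ 2 = 1 - c ^+ 2)%R by rewrite -cs addrAC subrr add0r.
  have -> : (u + s * (c * v + - (s * u)) = u + s * c * v - s ^+ 2 * u)%R by ring.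
  by rewrite s2; field.
by [].
Qed.

End affine.

Section gauss_integrals.
Context {R : realType}.
Local Open Scope ereal_scope.

Lemma ge0_integral_gaussS n (f : 'rV[R]_n.+1 -> \bar R) :
  measurable_fun setT f -> (forall x, 0 <= f x) ->
  \int[gauss n.+1]_x f x = \int[std]_t \int[gauss n]_v f (rvcons (t, v)).
Proof.
move=> mf f0; rewrite [LHS]ge0_integral_distribution//.
have mfr := measurableT_comp mf (@measurable_rvcons R n).
exact: (fubini_tonelli1 (f \o rvcons) mfr (fun p => f0 _)).
Qed.

Lemma ge0_integral_gauss0 (f : 'rV[R]_0 -> \bar R) :
  measurable_fun setT f -> (forall x, 0 <= f x) ->
  \int[gauss 0]_x f x = f 0%R.
Proof. by move=> mf f0; rewrite integral_dirac// diracT mul1e. Qed.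

Lemma measurable_fun_slice n (f : 'rV[R]_n.+1 -> \bar R) t :
  measurable_fun setT f -> measurable_fun setT (fun v => f (rvcons (t, v))).
Proof.
move=> mf; apply: (measurableT_comp mf).
exact: (measurableT_comp (@measurable_rvcons R n) (pair1_measurable t)).
Qed.

Lemma measurable_rvcons_pair d (T : measurableType d) n (f : T -> R)
    (g : T -> 'rV[R]_n) : measurable_fun setT f -> measurable_fun setT g ->
  measurable_fun setT (fun x => rvcons (f x, g x)).
Proof.
move=> mf mg; apply: (measurableT_comp (@measurable_rvcons R n)).
exact: measurable_fun_pair.
Qed.

Lemma rvconsZ n (a t : R) (v : 'rV[R]_n) :
  (a *: rvcons (t, v) = rvcons (a * t, a *: v))%R.
Proof.
apply/rowP => i; rewrite [LHS]mxE.
case: (unliftP ord0 i) => [j|] ->; last by rewrite !rvcons0.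
by rewrite !rvconsS [RHS]mxE.
Qed.

Lemma rvconsD n (t u : R) (v w : 'rV[R]_n) :
  (rvcons (t, v) + rvcons (u, w) = rvcons (t + u, v + w))%R.
Proof.
apply/rowP => i; rewrite [LHS]mxE.
case: (unliftP ord0 i) => [j|] ->; last by rewrite !rvcons0.
by rewrite !rvconsS [RHS]mxE.
Qed.

Lemma gauss_dilation n (l : R) (f : 'rV[R]_n -> \bar R) : (0 < l)%R ->
  measurable_fun setT f -> (forall x, 0 <= f x) ->
  \int[gauss n]_x f x = \int[gauss n]_x (f (l^-1 *: x)%R *
    (expR (\sum_(i < n) ((1 - l ^- 2) / 2 * x ord0 i ^+ 2 - ln l)))%:E).
Proof.
move=> l0.
pose w m (x : 'rV[R]_m) := expR (\sum_(i < m) ((1 - l ^- 2) / 2 * x ord0 i ^+ 2 - ln l)).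
have mw m : measurable_fun setT (fun x => (w m x)%:E).
  apply/measurable_EFinP; apply: measurableT_comp => //.
  apply: measurable_sum => i; apply: measurable_funB => //; apply: measurable_funM => //.
  by apply: measurable_funX; exact: measurable_coord.
have mfl m (g : 'rV[R]_m -> \bar R) : measurable_fun setT g ->
    measurable_fun setT (fun x : 'rV[R]_m => g (l^-1 *: x)%R).
  by move=> mg; apply: (measurableT_comp mg); exact: measurable_rvZ.
have mgw m (g : 'rV[R]_m -> \bar R) : measurable_fun setT g ->
    measurable_fun setT (fun x : 'rV[R]_m => g (l^-1 *: x)%R * (w m x)%:E).
  by move=> mg; exact: (emeasurable_funM (mfl m g mg) (mw m)).
have gw0 m (g : 'rV[R]_m -> \bar R) : (forall x, 0 <= g x) ->
    forall x : 'rV[R]_m, 0 <= g (l^-1 *: x)%R * (w m x)%:E.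
  by move=> g0 x; rewrite mule_ge0// lee_fin expR_ge0.
elim: n f => [|n IH] f mf f0; first rewrite !ge0_integral_gauss0//.
- by rewrite big_ord0 expR0 mule1; congr f; apply/rowP => -[].
- exact: (mgw 0%N f).
- exact: (gw0 0%N f).
rewrite !ge0_integral_gaussS//; [|exact: (mgw n.+1 f)|exact: (gw0 n.+1 f)].
rewrite (std_dilation l)//; first last.
- by move=> x; exact: integral_ge0.
- apply: (measurable_fun_fubini_tonelli_F (f \o rvcons)).
    exact: (measurableT_comp mf (@measurable_rvcons R n)).
  by move=> p; exact: f0.
apply: eq_integral => t _.
rewrite (IH (fun v => f (rvcons (l^-1 * t, v)%R)))//; last exact: measurable_fun_slice.
rewrite -ge0_integralZr//; first last.
- by move=> v _; apply: (gw0 n (fun v => f (rvcons (l^-1 * t, v)%R))).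
- exact: (mgw n _ (measurable_fun_slice n f (l^-1 * t)%R mf)).
apply: eq_integral => v _; rewrite -muleA -EFinM; congr (_ * _%:E).
  by rewrite rvconsZ.
rewrite -expRD big_ord_recl rvcons0 addrC; congr (expR (_ + _)%R).
by apply: eq_bigr => i _; rewrite rvconsS.
Qed.

Definition rotation n (c s : R) (p : 'rV[R]_n * 'rV[R]_n) : 'rV[R]_n * 'rV[R]_n :=
  (c *: p.1 + s *: p.2, c *: p.2 - s *: p.1)%R.
Arguments rotation {n}.

Lemma measurable_rotation n c s : measurable_fun setT (@rotation n c s).
Proof.
pose T := ('rV[R]_n * 'rV[R]_n)%type.
have m1 : measurable_fun [set: T] (fun p : T => p.1) by exact: measurable_fst.
have m2 : measurable_fun [set: T] (fun p : T => p.2) by exact: measurable_snd.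
apply/measurable_fun_pairP; split.
  exact: (measurable_rvD _ _ _ _ _ (measurable_rvZ _ _ _ c _ m1) (measurable_rvZ _ _ _ s _ m2)).
rewrite (_ : snd \o _ = (fun p : T => c *: p.2 + (- s) *: p.1)%R); last first.
  by apply/funext => p /=; rewrite scaleNr.
exact: (measurable_rvD _ _ _ _ _ (measurable_rvZ _ _ _ c _ m2) (measurable_rvZ _ _ _ (- s)%R _ m1)).
Qed.

(** Brings the two first coordinates outside, so that [std_rotation] can act on [(t, u)] and an
    induction hypothesis on [(v, w)]. *)
Lemma ge0_integral_gaussSS n (F : 'rV[R]_n.+1 * 'rV[R]_n.+1 -> \bar R) :
  measurable_fun setT F -> (forall x, 0 <= F x) ->
  \int[gauss n.+1]_x \int[gauss n.+1]_y F (x, y) =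
  \int[std]_t \int[std]_u \int[gauss n]_v \int[gauss n]_w
     F (rvcons (t, v), rvcons (u, w)).
Proof.
move=> mF F0.
rewrite ge0_integral_gaussS; first last.
- by move=> x; exact: integral_ge0.
- exact: (measurable_fun_fubini_tonelli_F F).
apply: eq_integral => t _.
pose G (p : 'rV[R]_n * R) := \int[gauss n]_w F (rvcons (t, p.1), rvcons (p.2, w)).
transitivity (\int[gauss n]_v \int[std]_u G (v, u)).
  apply: eq_integral => v _; rewrite ge0_integral_gaussS//.
  exact: (measurableT_comp mF (pair1_measurable _)).
apply: (fubini_tonelli G) => [|p]; last exact: integral_ge0.
apply: (measurable_fun_fubini_tonelli_F
  (fun q : ('rV[R]_n * R) * 'rV[R]_n => F (rvcons (t, q.1.1), rvcons (q.1.2, q.2)))) => //.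
have m11 : measurable_fun [set: ('rV[R]_n * R) * 'rV[R]_n] (fun q => q.1.1).
  exact: (measurableT_comp measurable_fst measurable_fst).
have m12 : measurable_fun [set: ('rV[R]_n * R) * 'rV[R]_n] (fun q => q.1.2).
  exact: (measurableT_comp measurable_snd measurable_fst).
apply: (measurableT_comp mF); apply: measurable_fun_pair.
  by apply: measurable_rvcons_pair => //; exact: measurable_cst.
exact: measurable_rvcons_pair.
Qed.

Lemma gauss_rotation n (c s : R) (F : 'rV[R]_n * 'rV[R]_n -> \bar R) :
  (0 < c)%R -> (c ^+ 2 + s ^+ 2 = 1)%R ->
  measurable_fun setT F -> (forall x, 0 <= F x) ->
  \int[gauss n]_x \int[gauss n]_y F (x, y) =
  \int[gauss n]_x \int[gauss n]_y F (rotation c s (x, y)).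
Proof.
move=> c0 cs.
have mFr m (G : 'rV[R]_m * 'rV[R]_m -> \bar R) : measurable_fun setT G ->
    measurable_fun setT (G \o rotation c s).
  by move=> mG; apply: (measurableT_comp mG); exact: measurable_rotation.
elim: n F => [|n IH] F mF F0; have mFr0 := mFr _ _ mF;
  have Fr0 p : 0 <= (F \o rotation c s) p by exact: F0.
  have m0 (G : 'rV[R]_0 * 'rV[R]_0 -> \bar R) : measurable_fun setT G ->
      (forall x, 0 <= G x) -> \int[gauss 0]_x \int[gauss 0]_y G (x, y) = G (0, 0)%R.
    move=> mG G0; rewrite ge0_integral_gauss0; first last.
    - by move=> x; exact: integral_ge0.
    - exact: (measurable_fun_fubini_tonelli_F G).
    by rewrite ge0_integral_gauss0//; exact: (measurableT_comp mG (pair1_measurable _)).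
  rewrite m0// (m0 (F \o rotation c s))//.
  by rewrite /rotation/=; congr (F (_, _)); apply/rowP => -[].
apply: (etrans (ge0_integral_gaussSS n F mF F0)).
apply: (etrans _ (esym (ge0_integral_gaussSS n _ mFr0 Fr0))).
pose H (p : R * R) := \int[gauss n]_v \int[gauss n]_w
     F (rvcons (p.1, v), rvcons (p.2, w)).
pose T := ((R * R) * 'rV[R]_n)%type.
have m11 : measurable_fun [set: T * 'rV[R]_n] (fun q => q.1.1.1).
  by apply: (measurableT_comp measurable_fst); exact: (measurableT_comp measurable_fst measurable_fst).
have m12 : measurable_fun [set: T * 'rV[R]_n] (fun q => q.1.1.2).
  by apply: (measurableT_comp measurable_snd); exact: (measurableT_comp measurable_fst measurable_fst).
have m21 : measurable_fun [set: T * 'rV[R]_n] (fun q => q.1.2).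
  exact: (measurableT_comp measurable_snd measurable_fst).
pose G (q : T * 'rV[R]_n) := F (rvcons (q.1.1.1, q.1.2), rvcons (q.1.1.2, q.2)).
have mG : measurable_fun setT G.
  apply: (measurableT_comp mF); apply: measurable_fun_pair; first exact: measurable_rvcons_pair.
  by apply: measurable_rvcons_pair => //; exact: measurable_snd.
have G0 q : 0 <= G q by exact: F0.
pose G1 (q : T) := \int[gauss n]_w G (q, w).
have mG1 : measurable_fun setT G1 by exact: (measurable_fun_fubini_tonelli_F G).
have G10 q : 0 <= G1 q by exact: integral_ge0.
have mH : measurable_fun setT H by exact: (measurable_fun_fubini_tonelli_F G1).
have mFp (p : R * R) : measurable_fun setT
    (fun q : 'rV[R]_n * 'rV[R]_n => F (rvcons (p.1, q.1), rvcons (p.2, q.2))).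
  apply: (measurableT_comp mF); apply: measurable_fun_pair;
    exact: measurable_rvcons_pair.
have H0 p : 0 <= H p by apply: integral_ge0 => v _; exact: integral_ge0.
apply: (etrans (std_rotation c s H c0 cs mH H0)).
apply: eq_integral => t _; apply: eq_integral => u _.
apply: (etrans (IH _ (mFp (c * t + s * u, c * u - s * t)%R) (fun q => F0 _))).
apply: eq_integral => v _; apply: eq_integral => w _.
rewrite /rotation/= -!scaleNr !rvconsZ !rvconsD !mulNr.
by congr (F (_, rvcons (_ + _, _)))%R; exact: mulNr.
Qed.

End gauss_integrals.
Arguments rotation {R n}.

(** * Probabilities as real numbers *)

Section real_probability.
Context {d} {T : measurableType d} {R : realType} (P : probability T R).

Definition pr (A : set T) : R := fine (P A).

Lemma prE A : measurable A -> P A = (pr A)%:E.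
Proof. by move=> mA; rewrite fineK// fin_num_measure. Qed.

Lemma pr_ge0 A : 0 <= pr A.
Proof. exact: fine_ge0. Qed.

Lemma pr_mono A B : measurable A -> measurable B -> A `<=` B -> pr A <= pr B.
Proof. by move=> mA mB AB; rewrite -lee_fin -!prE// le_measure// inE. Qed.

Lemma pr_le1 A : measurable A -> pr A <= 1.
Proof. by move=> mA; rewrite -lee_fin -prE//; exact: probability_le1. Qed.

Lemma pr_setU_le A B : measurable A -> measurable B -> pr (A `|` B) <= pr A + pr B.
Proof.
move=> mA mB; rewrite -lee_fin EFinD -!prE//; last exact: measurableU.
exact: measureU2.
Qed.

Lemma pr_setU A B : measurable A -> measurable B -> A `&` B = set0 ->
  pr (A `|` B) = pr A + pr B.
Proof.
move=> mA mB AB; apply/EFin_inj; rewrite EFinD -!prE//; last exact: measurableU.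
by rewrite measureU.
Qed.

Lemma pr_setC A : measurable A -> pr (~` A) = 1 - pr A.
Proof.
move=> mA; apply/EFin_inj; rewrite EFinB -!prE//; last exact: measurableC.
by rewrite probability_setC.
Qed.

Lemma pr_setD A B : measurable A -> measurable B -> A `<=` B ->
  pr (B `\` A) = pr B - pr A.
Proof.
move=> mA mB AB; have mBA : measurable (B `\` A) by exact: measurableD.
rewrite -[in RHS](setDUK AB) pr_setU//; first by rewrite addrAC subrr add0r.
by rewrite setDE setICA setICr setI0.
Qed.

Lemma pr_bigsetU_le (A : nat -> set T) n : (forall k, measurable (A k)) ->
  pr (\big[setU/set0]_(k < n) A k) <= \sum_(k < n) pr (A k).
Proof.
move=> mA; elim: n => [|n IH]; first by rewrite !big_ord0 /pr measure0.
rewrite !big_ord_recr/= (le_trans (pr_setU_le _ _ _ _))//.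
  exact: bigsetU_measurable.
by rewrite lerD2r.
Qed.

End real_probability.

Section gauss_pairs.
Context {R : realType} (n : nat).
Notation g := (pr (@gauss R n)).
Definition gauss2 : probability ('rV[R]_n * 'rV[R]_n)%type R := (@gauss R n \x @gauss R n)%E.
Notation gg := (pr gauss2).

Lemma pair_rect (A B : set 'rV[R]_n) : measurable A -> measurable B ->
  gg (A `*` B) = g A * g B.
Proof. by move=> mA mB; rewrite /pr/= product_measure1E// fineM// fin_num_measure. Qed.

Lemma measurable_preimage_rotation c s (B : set ('rV[R]_n * 'rV[R]_n)) :
  measurable B -> measurable (rotation c s @^-1` B).
Proof. by move=> mB; rewrite -[X in measurable X]setTI; apply: measurable_rotation. Qed.

Lemma pair_rotation c s (B : set ('rV[R]_n * 'rV[R]_n)) : measurable B ->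
  0 < c -> c ^+ 2 + s ^+ 2 = 1 -> gg (rotation c s @^-1` B) = gg B.
Proof.
move=> mB c0 cs; congr fine.
have mB' := measurable_preimage_rotation c s B mB.
pose I (A : set ('rV[R]_n * 'rV[R]_n)) x := (\1_A x : R)%:E.
have mI A : measurable A -> measurable_fun setT (I A).
  by move=> mA; apply/measurable_EFinP.
have I0 A x : (0 <= I A x)%E by rewrite lee_fin.
have E A : measurable A -> gauss2 A = (\int[gauss n]_x \int[gauss n]_y I A (x, y))%E.
  move=> mA; transitivity (\int[gauss2]_z I A z)%E; first by rewrite integral_indic// setIT.
  exact: (fubini_tonelli1 (I A) (mI _ mA) (I0 A)).
apply: (etrans (E _ mB')); apply: (etrans _ (esym (E _ mB))).
exact: (esym (gauss_rotation n c s (I B) c0 cs (mI _ mB) (I0 B))).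
Qed.

End gauss_pairs.

(** * Second moments *)

Section second_moment.
Context {R : realType}.
Local Open Scope ereal_scope.

Lemma integral_cst_prob d (T : measurableType d) (P : probability T R) (r : \bar R) :
  \int[P]_x r = r.
Proof.
rewrite integral_cst// -[RHS]mule1; congr (_ * _); exact: probability_setT.
Qed.

Lemma ln_leB1 (l : R) : (0 < l -> ln l <= l - 1)%R.
Proof. by move=> l0; have := expR_ge1Dx (ln l); rewrite lnK ?posrE//; lra. Qed.

Lemma measurable_EFin_sqr : measurable_fun [set: R] (fun x : R => (x ^+ 2)%:E).
Proof. by apply/measurable_EFinP; exact: measurable_funX. Qed.

Lemma std_dilation_mass (l : R) : (0 < l)%R ->
  \int[std]_x (expR ((1 - l ^- 2) / 2 * x ^+ 2 - ln l))%:E = 1.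
Proof.
move=> l0; have := std_dilation l (cst 1) l0 (measurable_cst _) (fun _ => lee01).
rewrite integral_cst_prob => ->.
by apply: eq_integral => x _; rewrite mul1e.
Qed.

Lemma measurable_dilation_weight (l : R) :
  measurable_fun [set: R] (fun x : R => (expR ((1 - l ^- 2) / 2 * x ^+ 2 - ln l))%:E).
Proof.
apply/measurable_EFinP; apply: measurableT_comp => //.
by apply: measurable_funB => //; apply: measurable_funM => //; exact: measurable_funX.
Qed.

(** The dilation weight has total mass 1 for every [l]. Bounding it below by [1 + v] gives
    [k * moment <= ln l] with [k = (1 - l^-2) / 2], and [ln l <= l - 1 <= k l^2]. For [l < 1] the
    sign of [k] changes and the same inequality bounds the moment from below; letting [l] tend to 1
    determines it. *)
Lemma std_moment2_le (l : R) : (1 < l)%R -> \int[std]_x (x ^+ 2)%:E <= (l ^+ 2)%:E.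
Proof.
move=> l1; have l0 : (0 < l)%R by lra.
have ln0 : (0 <= ln l)%R by rewrite ln_ge0// ltW.
pose k := ((1 - l ^- 2) / 2)%R.
have k0 : (0 < k)%R.
  by rewrite /k divr_gt0// subr_gt0 invf_lt1 ?exprn_gt0// exprn_egt1.
have H : 1 + k%:E * \int[std]_x (x ^+ 2)%:E <= 1 + (ln l)%:E.
  have -> : 1 + k%:E * \int[std]_x (x ^+ 2)%:E = \int[std]_x (1 + k%:E * (x ^+ 2)%:E).
    rewrite ge0_integralD//.
    - rewrite integral_cst_prob ge0_integralZl//.
      + exact: measurable_EFin_sqr.
      + by move=> x _; rewrite lee_fin sqr_ge0.
      + by rewrite lee_fin ltW.
    - by move=> x _; rewrite mule_ge0 ?lee_fin ?sqr_ge0// ltW.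
    - by apply: measurable_funeM; exact: measurable_EFin_sqr.
  have -> : 1 + (ln l)%:E =
      \int[std]_x ((expR ((1 - l ^- 2) / 2 * x ^+ 2 - ln l))%:E + (ln l)%:E).
    rewrite ge0_integralD//.
    - by rewrite std_dilation_mass// integral_cst_prob.
    - exact: measurable_dilation_weight.
  apply: ge0_le_integral => //.
  - by move=> x _; rewrite adde_ge0// mule_ge0 ?lee_fin ?sqr_ge0// ltW.
  - by apply: emeasurable_funD => //; apply: measurable_funeM; exact: measurable_EFin_sqr.
  - by apply: emeasurable_funD => //; exact: measurable_dilation_weight.
  - move=> x _; rewrite -EFinM -!EFinD lee_fin.
    have := expR_ge1Dx ((1 - l ^- 2) / 2 * x ^+ 2 - ln l)%R; rewrite -/k; lra.
have : k%:E * \int[std]_x (x ^+ 2)%:E <= (ln l)%:E by rewrite -(leeD2lE (x := 1)).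
rewrite muleC -lee_pdivlMr// => /le_trans; apply.
rewrite -EFinM lee_fin.
rewrite ler_pdivrMr// /k.
have := ln_leB1 l l0.
have : (l ^+ 2 * ((1 - l ^- 2) / 2) = (l ^+ 2 - 1) / 2)%R by field; rewrite gt_eqF.
move=> ->; nra.
Qed.

Lemma std_moment2_ge (l : R) : (0 < l < 1)%R -> (l ^+ 2)%:E <= \int[std]_x (x ^+ 2)%:E.
Proof.
move=> /andP[l0 l1].
have ln0 : (ln l <= 0)%R by rewrite ln_le0// ltW.
pose k := (- ((1 - l ^- 2) / 2))%R.
have k0 : (0 < k)%R.
  by rewrite /k oppr_gt0 pmulr_llt0// subr_lt0 invf_gt1 ?exprn_gt0// exprn_ilt1// ltW.
have H : 1 + (- ln l)%:E <= 1 + k%:E * \int[std]_x (x ^+ 2)%:E.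
  have -> : 1 + (- ln l)%:E = \int[std]_x (1 + (- ln l)%:E).
    by rewrite integral_cst_prob.
  have -> : 1 + k%:E * \int[std]_x (x ^+ 2)%:E =
      \int[std]_x ((expR ((1 - l ^- 2) / 2 * x ^+ 2 - ln l))%:E + k%:E * (x ^+ 2)%:E).
    rewrite ge0_integralD//.
    - rewrite std_dilation_mass// ge0_integralZl//.
      + exact: measurable_EFin_sqr.
      + by move=> x _; rewrite lee_fin sqr_ge0.
      + by rewrite lee_fin ltW.
    - exact: measurable_dilation_weight.
    - by move=> x _; rewrite mule_ge0 ?lee_fin ?sqr_ge0// ltW.
    - by apply: measurable_funeM; exact: measurable_EFin_sqr.
  apply: ge0_le_integral => //.
  - by move=> x _; rewrite -EFinD lee_fin; lra.
  - apply: emeasurable_funD; first exact: measurable_dilation_weight.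
    by apply: measurable_funeM; exact: measurable_EFin_sqr.
  - move=> x _; rewrite -EFinM -!EFinD lee_fin.
    have := expR_ge1Dx ((1 - l ^- 2) / 2 * x ^+ 2 - ln l)%R; rewrite /k; lra.
have : (- ln l)%:E <= k%:E * \int[std]_x (x ^+ 2)%:E by rewrite -(leeD2lE (x := 1)).
rewrite muleC -lee_pdivrMr//; apply: le_trans.
rewrite -EFinM lee_fin ler_pdivlMr// /k.
have := ln_leB1 l l0.
have : (l ^+ 2 * (- ((1 - l ^- 2) / 2)) = (1 - l ^+ 2) / 2)%R by field; rewrite gt_eqF.
move=> ->; nra.
Qed.

Lemma std_moment2 : \int[std]_x ((x : R) ^+ 2)%:E = 1.
Proof.
have le4 := std_moment2_le 2 (ltr1n _ 2).
have M0 : 0 <= \int[std]_x ((x : R) ^+ 2)%:E.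
  by apply: integral_ge0 => x _; rewrite lee_fin sqr_ge0.
have ub := std_moment2_le; have lb := std_moment2_ge.
have fM : \int[std]_x ((x : R) ^+ 2)%:E \is a fin_num.
  by rewrite ge0_fin_numE//; apply: le_lt_trans le4 _; exact: ltry.
move: ub lb M0; rewrite -(fineK fM); set M := fine _ => ub lb.
rewrite lee_fin => M0; congr EFin; apply/eqP; rewrite eq_le; apply/andP; split.
  rewrite leNgt; apply/negP => M1.
  have s1 : (1 < Num.sqrt M)%R by rewrite -sqrtr1 ltr_sqrt//; lra.
  (* This [l] lies strictly between 1 and [sqrt M], so [l^2 < M], against the upper bound. *)
  have := ub ((1 + Num.sqrt M) / 2)%R; rewrite lee_fin.
  have := sqr_sqrtr M0; nra.
rewrite leNgt; apply/negP => M1.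
have s1 : (Num.sqrt M < 1)%R by rewrite -sqrtr1 ltr_sqrt.
have s0 := sqrtr_ge0 M.
have := lb ((1 + Num.sqrt M) / 2)%R; rewrite lee_fin.
have := sqr_sqrtr M0; nra.
Qed.

Lemma gauss_marginal n (i : 'I_n) (f : R -> \bar R) : measurable_fun setT f ->
  (forall x, 0 <= f x) -> \int[gauss n]_x f (x ord0 i) = \int[std]_t f t.
Proof.
move=> mf f0; elim: n i => [[]//|n IH] i.
rewrite ge0_integral_gaussS//; last exact: (measurableT_comp mf (measurable_coord i)).
case: (unliftP ord0 i) => [j|] ->.
  transitivity (\int[std]_t \int[gauss n]_v f (v ord0 j)).
    by apply: eq_integral => t _; apply: eq_integral => v _; rewrite rvconsS.
  by rewrite IH integral_cst_prob.
apply: eq_integral => t _; transitivity (\int[gauss n]_v f t).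
  by apply: eq_integral => v _; rewrite rvcons0.
by rewrite integral_cst_prob.
Qed.

Lemma gauss_moment2 n (i : 'I_n) : \int[gauss n]_x ((x ord0 i : R) ^+ 2)%:E = 1.
Proof.
rewrite (gauss_marginal n i (fun t => (t ^+ 2)%:E)) ?std_moment2//.
  exact: measurable_EFin_sqr.
by move=> x; rewrite lee_fin sqr_ge0.
Qed.

Definition nsq n (x : 'rV[R]_n) : R := (\sum_(i < n) x ord0 i ^+ 2)%R.

Lemma nsq_ge0 n (x : 'rV[R]_n) : (0 <= nsq n x)%R.
Proof. by apply: sumr_ge0 => i _; exact: sqr_ge0. Qed.

Lemma measurable_nsq n : measurable_fun setT (nsq n).
Proof.
by apply: measurable_sum => i; apply: measurable_funX; exact: measurable_coord.
Qed.

Lemma gauss_nsq n : \int[gauss n]_x (nsq n x)%:E = n%:R%:E.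
Proof.
under eq_integral do rewrite -sumEFin.
rewrite ge0_integral_sum//.
- under eq_bigr do rewrite gauss_moment2.
  by rewrite sumEFin sumr_const card_ord.
- move=> i; apply/measurable_EFinP; apply: measurable_funX; exact: measurable_coord.
- by move=> i x _; rewrite lee_fin sqr_ge0.
Qed.

End second_moment.

(** * Measure of the dilates of a convex body *)

Section dilates.
Context {R : realType} {n : nat} (C : set 'rV[R]_n).

(** The dilate [l C] for nonzero [l], written as a preimage so that measurability is immediate. *)
Definition dil (l : R) : set 'rV[R]_n := [set x | C (l^-1 *: x)].

Lemma dil1 : dil 1 = C.
Proof. by apply/seteqP; split => x; rewrite /dil/= invr1 scale1r. Qed.

Lemma measurable_dil l : measurable C -> measurable (dil l).
Proof.
move=> mC; have := measurable_rvZ _ _ n l^-1 id (@measurable_id _ _ setT).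
by move=> /(_ measurableT _ mC); rewrite setTI.
Qed.

Lemma dilZ a l x : 0 < a -> dil l x -> dil (a * l) (a *: x).
Proof.
move=> a0; rewrite /dil/= scalerA invfM mulrAC mulVf ?mul1r//.
by rewrite gt_eqF.
Qed.

Lemma dilN l x : (forall x, C x -> C (- x)) -> dil l x -> dil l (- x).
Proof. by move=> symC; rewrite /dil/= scalerN => /symC. Qed.

Hypothesis convC : forall x y a b, C x -> C y -> 0 <= a -> 0 <= b -> a + b = 1 ->
  C (a *: x + b *: y).

Lemma dilD l m x y : 0 < l -> 0 < m -> dil l x -> dil m y -> dil (l + m) (x + y).
Proof.
move=> l0 m0 lx my; rewrite /dil/=.
have lm : l + m != 0 by rewrite gt_eqF// addr_gt0.
have -> : (l + m)^-1 *: (x + y) =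
    (l / (l + m)) *: (l^-1 *: x) + (m / (l + m)) *: (m^-1 *: y).
  by rewrite !scalerA scalerDr; congr (_ *: _ + _ *: _); field;
    rewrite lm gt_eqF.
by apply: convC => //; rewrite ?divr_ge0 ?addr_ge0 ?ltW// -mulrDl divff.
Qed.

Hypothesis C0 : C 0.

Lemma dil_mono l m x : 0 < l -> l <= m -> dil l x -> dil m x.
Proof.
move=> l0 lm; rewrite /dil/= => Cx.
have m0 : 0 < m by exact: lt_le_trans lm.
have -> : m^-1 *: x = (l / m) *: (l^-1 *: x) + (1 - l / m) *: 0.
  by rewrite scaler0 addr0 scalerA; congr (_ *: _); field; rewrite !gt_eqF.
apply: convC => //; first by rewrite divr_ge0// ltW.
  by rewrite subr_ge0 ler_pdivrMr// mul1r.
by rewrite addrC subrK.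
Qed.

End dilates.

Section growth.
Context {R : realType} {n : nat} (C : set 'rV[R]_n).
Hypothesis mC : measurable C.
Hypothesis starC : forall l x, 1 <= l -> C x -> dil C l x.
Notation g := (pr (@gauss R n)).

Definition mass2 : R := fine (\int[gauss n]_(x in C) (nsq n x)%:E)%E.

Lemma measurable_EFin_nsq (D : set 'rV[R]_n) : measurable_fun D (fun x => (nsq n x)%:E).
Proof. by apply: measurable_funTS; apply/measurable_EFinP; exact: measurable_nsq. Qed.

Lemma mass2_le_ereal (D : set 'rV[R]_n) : measurable D ->
  (\int[gauss n]_(x in D) (nsq n x)%:E <= n%:R%:E)%E.
Proof.
move=> mD; rewrite -gauss_nsq; apply: ge0_subset_integral => //.
- exact: measurable_EFin_nsq.
- by move=> x _; rewrite lee_fin nsq_ge0.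
Qed.

Lemma mass2E : (\int[gauss n]_(x in C) (nsq n x)%:E = mass2%:E)%E.
Proof.
rewrite fineK// ge0_fin_numE; first exact: le_lt_trans (mass2_le_ereal _ mC) (ltry _).
by apply: integral_ge0 => x _; rewrite lee_fin nsq_ge0.
Qed.

Lemma mass2_ge0 : 0 <= mass2.
Proof. by apply: fine_ge0; apply: integral_ge0 => x _; rewrite lee_fin nsq_ge0. Qed.

Lemma mass2_le : mass2 <= n%:R.
Proof. by rewrite -lee_fin -mass2E mass2_le_ereal. Qed.

(* Change variables [x -> x / l] in [g(C)] and apply [exp v >= 1 + v] to the
   resulting density on the dilate. *)
Lemma dil_growth_first l : 1 <= l ->
  g (dil C l) + (1 - l ^- 2) / 2 * mass2 <= g C + n%:R * ln l * g (dil C l).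
Proof.
move=> l1; have l0 : 0 < l by exact: lt_le_trans l1.
have ln0 : 0 <= ln l by rewrite ln_ge0.
pose k := (1 - l ^- 2) / 2.
have k0 : 0 <= k.
  by rewrite /k divr_ge0// subr_ge0 invf_le1 ?exprn_gt0// exprn_ege1.
have mD := measurable_dil C l mC.
have mCI : measurable_fun setT (fun x => (\1_C x : R)%:E) by apply/measurable_EFinP.
pose w (x : 'rV[R]_n) := expR (\sum_(i < n) (k * x ord0 i ^+ 2 - ln l)).
have mw : measurable_fun setT (fun x => (w x)%:E).
  apply/measurable_EFinP; apply: measurableT_comp => //.
  apply: measurable_sum => i; apply: measurable_funB => //; apply: measurable_funM => //.
  by apply: measurable_funX; exact: measurable_coord.
have nl0 : 0 <= n%:R * ln l by rewrite mulr_ge0.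
have gC : (g C)%:E = (\int[gauss n]_(x in dil C l) (w x)%:E)%E.
  rewrite -prE// -[C in LHS]setIT -integral_indic// [RHS]integral_mkcond.
  rewrite [LHS](gauss_dilation n l (fun x => (\1_C x)%:E) l0 mCI)//.
  apply: eq_integral => x _; rewrite patchE indicE.
  have -> : (l^-1 *: x \in C) = (x \in dil C l) by apply: asbool_equiv_eq.
  by case: ifP => _; rewrite ?mul1e ?mul0e.
have mn := measurable_EFin_nsq (dil C l).
have n0 x : dil C l x -> (0 <= k%:E * (nsq n x)%:E)%E.
  by move=> _; rewrite mule_ge0// lee_fin nsq_ge0.
have mkn : measurable_fun (dil C l) (fun x => k%:E * (nsq n x)%:E)%E by exact: measurable_funeM.
have mwD : measurable_fun (dil C l) (fun x => (w x)%:E) by exact: measurable_funTS.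
rewrite -lee_fin !EFinD !(EFinM _ mass2) (EFinM _ (g (dil C l))) -mass2E gC -prE//.
apply: (@le_trans _ _ (\int[gauss n]_(x in dil C l) (1 + k%:E * (nsq n x)%:E))%E).
  rewrite ge0_integralD// integral_cst// mul1e leeD2l// ge0_integralZl//.
    rewrite lee_wpmul2l// ge0_subset_integral//.
    - by move=> x _; rewrite lee_fin nsq_ge0.
    - by move=> x Cx; exact: starC.
  by move=> x _; rewrite lee_fin nsq_ge0.
rewrite -[X in (_ <= _ + X)%E]integral_cst// -ge0_integralD//; last first.
  by move=> x _; rewrite lee_fin expR_ge0.
apply: ge0_le_integral => //.
- by move=> x Dx; rewrite adde_ge0// n0.
- exact: emeasurable_funD.
- exact: emeasurable_funD.
- move=> x _; rewrite -EFinM -!EFinD lee_fin.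
  have := expR_ge1Dx (\sum_(i < n) (k * x ord0 i ^+ 2 - ln l)).
  rewrite -/(w x) big_split/= sumr_const card_ord -mulr_sumr -/(nsq n x) -mulr_natl.
  lra.
Qed.

(** Second-order form of [dil_growth_first] at [l = 1 + e]. Replacing [g(l C)] by [g(C)] on the
    right costs [(n e)^2], by the crude bound [g(l C) - g(C) <= n e]; expanding [(1 - l^-2) / 2]
    costs at most [3/2 n e^2], since [mass2 <= n]. *)
Lemma dil_growth e : 0 <= e ->
  g (dil C (1 + e)) - g C <= e * (n%:R * g C - mass2) + (n%:R ^+ 2 + 2 * n%:R) * e ^+ 2.
Proof.
move=> e0; have e1 : 1 <= 1 + e by lra.
have ep : 0 < 1 + e by lra.
have := dil_growth_first _ e1.
set p := g (dil C (1 + e)); set k := (1 - _) / 2.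
have p1 : p <= 1 by apply: pr_le1; exact: measurable_dil.
have p0 : 0 <= p by exact: pr_ge0.
have q1 : g C <= p.
  by apply: pr_mono => //; [exact: measurable_dil|by move=> x; exact: starC].
have q0 : 0 <= g C by exact: pr_ge0.
have n0 : 0 <= n%:R :> R by [].
have ln1 : ln (1 + e) <= e by have := ln_leB1 _ ep; lra.
have m0 := mass2_ge0; have mn := mass2_le.
have kl : e - 3 / 2 * e ^+ 2 <= k.
  have ep2 : 0 < (1 + e) ^+ 2 by rewrite exprn_gt0.
  have : (1 + e) ^- 2 <= 1 - 2 * e + 3 * e ^+ 2.
    rewrite -div1r ler_pdivrMr//.
    have -> : (1 - 2 * e + 3 * e ^+ 2) * (1 + e) ^+ 2 = 1 + 4 * e ^+ 3 + 3 * e ^+ 4 by ring.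
    by have := exprn_ge0 3 e0; have := exprn_ge0 4 e0; lra.
  by rewrite /k; lra.
have k0 : 0 <= k.
  by rewrite /k divr_ge0// subr_ge0 invf_le1 ?exprn_gt0// exprn_ege1.
move=> H.
have H1 : n%:R * ln (1 + e) * p <= n%:R * e * p by rewrite ler_wpM2r// ler_wpM2l.
have D1 : p - g C <= n%:R * e.
  have : n%:R * e * p <= n%:R * e by rewrite ler_piMr// mulr_ge0.
  have : 0 <= k * mass2 by rewrite mulr_ge0.
  lra.
have D2 : n%:R * e * (p - g C) <= n%:R * e * (n%:R * e).
  by rewrite ler_wpM2l// mulr_ge0.
have D3 : (e - 3 / 2 * e ^+ 2) * mass2 <= k * mass2 by rewrite ler_wpM2r.
have D4 : 3 / 2 * e ^+ 2 * mass2 <= 3 / 2 * e ^+ 2 * n%:R.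
  by rewrite ler_wpM2l// mulr_ge0// sqr_ge0.
have D5 : 0 <= n%:R * e ^+ 2 by rewrite mulr_ge0// sqr_ge0.
have -> : e * (n%:R * g C - mass2) + (n%:R ^+ 2 + 2 * n%:R) * e ^+ 2 =
  n%:R * e * g C - e * mass2 + n%:R * e * (n%:R * e) + 2 * (n%:R * e ^+ 2) by ring.
lra.
Qed.

End growth.

(** * Noise sensitivity of a symmetric convex body *)

(** Stands in for every passage to the limit: the error terms are all arranged to be multiples of
    [2^-k]. *)
Lemma le_geometric_limit (R : realType) (x y z : R) :
  (forall k, x <= y + 2 ^- k * z) -> x <= y.
Proof.
move=> H; rewrite leNgt; apply/negP => yx.
have d0 : 0 < x - y by lra.
have z0 : 0 <= `|z| / (x - y) by rewrite divr_ge0// ltW.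
set m := Num.bound (`|z| / (x - y)).
have m1 : `|z| / (x - y) < m%:R by exact: archi_boundP.
have m2 : m%:R < 2 ^+ m :> R by rewrite -natrX ltr_nat ltn_expl.
have p0 : 0 < 2 ^+ m :> R by rewrite exprn_gt0.
have := H m; rewrite leNgt => /negP; apply.
rewrite addrC -ltrBrDr mulrC ltr_pdivrMr// (le_lt_trans (ler_norm z))//.
rewrite mulrC -ltr_pdivrMr//; exact: lt_trans m2.
Qed.

Section noise.
Context {R : realType} {n : nat} (C : set 'rV[R]_n).
Hypothesis mC : measurable C.
Hypothesis convC : forall x y a b, C x -> C y -> 0 <= a -> 0 <= b -> a + b = 1 ->
  C (a *: x + b *: y).
Hypothesis symC : forall x, C x -> C (- x).
Hypothesis C0 : C 0.
Notation g := (pr (@gauss R n)).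
Notation gg := (pr (@gauss2 R n)).

Let mD l : measurable (dil C l). Proof. exact: measurable_dil. Qed.

Definition noise_set (c s : R) : set ('rV[R]_n * 'rV[R]_n) :=
  [set p | C p.1 /\ ~ C (c *: p.1 + s *: p.2)].

Lemma measurable_preimage_lin (a b : R) (B : set 'rV[R]_n) : measurable B ->
  measurable [set p : 'rV[R]_n * 'rV[R]_n | B (a *: p.1 + b *: p.2)].
Proof.
pose T := ('rV[R]_n * 'rV[R]_n)%type.
have m1 : measurable_fun [set: T] (fun p : T => p.1) by exact: measurable_fst.
have m2 : measurable_fun [set: T] (fun p : T => p.2) by exact: measurable_snd.
move=> mB.
have := measurable_rvD _ _ _ _ _ (measurable_rvZ _ _ _ a _ m1) (measurable_rvZ _ _ _ b _ m2).
by move=> /(_ measurableT _ mB); rewrite setTI.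
Qed.

Lemma measurable_preimage_fst (B : set 'rV[R]_n) : measurable B ->
  measurable [set p : 'rV[R]_n * 'rV[R]_n | B p.1].
Proof.
move=> mB; have := measurable_preimage_lin 1 0 B mB.
by congr measurable; apply/seteqP; split => p /=; rewrite scale1r scale0r addr0.
Qed.

Lemma measurable_noise_set c s : measurable (noise_set c s).
Proof.
apply: measurableI; first exact: measurable_preimage_fst.
by apply: measurableC; exact: measurable_preimage_lin.
Qed.

Definition rho c s := gg (noise_set c s).

(** A rotation by the double angle is two equal rotations in succession. If the path starts in [C]
    and ends outside, it leaves [C] in the first half or in the second, and the second event is the
    pullback of the first by a measure-preserving rotation. *)
Lemma rho_double c s : 0 < c -> c ^+ 2 + s ^+ 2 = 1 ->
  rho (c ^+ 2 - s ^+ 2) (2 * c * s) <= 2 * rho c s.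
Proof.
move=> c0 cs.
rewrite (_ : 2 * rho c s = rho c s + gg (rotation c s @^-1` noise_set c s)); last first.
  rewrite pair_rotation//; first by rewrite -/(rho c s); ring.
  exact: measurable_noise_set.
have mr := measurable_preimage_rotation n c s _ (measurable_noise_set c s).
apply: (le_trans _ (pr_setU_le _ _ _ (measurable_noise_set c s) mr)).
apply: pr_mono.
- exact: measurable_noise_set.
- by apply: measurableU => //; exact: measurable_noise_set.
move=> [x y] [/= Cx nC].
have [Cz|nCz] := pselect (C (c *: x + s *: y)); last by left.
right; split => //= Cw; apply: nC; move: Cw; congr C.
by apply/rowP => i; rewrite !mxE; ring.
Qed.

(** A quarter turn makes the two points independent; this is the value from which the angles are
    halved. *)
Lemma rho01 : rho 0 1 = g C * (1 - g C).
Proof.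
rewrite -pr_setC// -pair_rect//; last exact: measurableC.
congr fine; congr (gauss2 n _); apply/seteqP.
by split => -[x y] /=; rewrite /noise_set/= scale0r scale1r add0r.
Qed.

(* The events [x \in C, y \notin t C] and [x \notin t C, y \in C] are disjoint, and
   the rotation by 45 degrees maps both into the event that neither coordinate lies in
   [t' C].  The resulting factor 2 makes the iteration converge for all
   [g(C) > 1/3], hence also around [1/2]. *)
Lemma fernique t t' : 0 < t' -> 1 + 3 / 2 * t' <= t ->
  2 * g C * (1 - g (dil C t)) <= (1 - g (dil C t')) ^+ 2.
Proof.
move=> t'0 tt'; have t1 : 1 <= t by lra.
have t0 : 0 < t by lra.
pose h : R := (Num.sqrt 2)^-1.
have h2 : h ^+ 2 + h ^+ 2 = 1.
  by rewrite /h exprVn sqr_sqrtr//; field.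
have h0 : 0 < h by rewrite invr_gt0 sqrtr_gt0.
have hh : h^-1 <= 3 / 2.
  rewrite invrK -(@ler_pXn2r _ 2)// ?nnegrE ?sqrtr_ge0// sqr_sqrtr//.
  by have -> : (3 / 2) ^+ 2 = 9 / 4 :> R; [field|lra].
(* Writing [v = -u + (u + v)] puts [v] in [C + sqrt 2 t' C], hence in [(1 + sqrt 2 t') C]; here
   [h^-1 = sqrt 2] is rounded up to [3/2]. *)
have key u v : C u -> dil C t' (h *: (u + v)) -> dil C t v.
  move=> Cu /(dilZ C h^-1 _ _ _); rewrite invr_gt0 h0 scalerA mulVf ?gt_eqF// scale1r.
  move=> /(_ isT) Cuv.
  have -> : v = (- u) + (u + v) by rewrite addrA addNr add0r.
  apply: (dil_mono C convC C0 (1 + h^-1 * t')).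
  - by rewrite addr_gt0// mulr_gt0// invr_gt0.
  - by apply: le_trans tt'; rewrite lerD2l ler_pM2r.
  - apply: (dilD C convC) => //; first by rewrite mulr_gt0// invr_gt0.
    by rewrite dil1; exact: symC.
have mCt := measurableC (mD t); have mCt' := measurableC (mD t').
pose U := C `*` (~` dil C t) `|` (~` dil C t) `*` C.
have mU1 : measurable (C `*` (~` dil C t)) by exact: measurableX.
have mU2 : measurable ((~` dil C t) `*` C) by exact: measurableX.
have -> : 2 * g C * (1 - g (dil C t)) = gg U.
  rewrite pr_setU//; first by rewrite !pair_rect// pr_setC//; ring.
  rewrite -subset0 => -[x y] [[/= Cx _] [nx _]]; apply: nx.
  by apply: (dil_mono C convC C0 1) => //; rewrite dil1.
have mR : measurable ((~` dil C t') `*` (~` dil C t')) by exact: measurableX.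
rewrite expr2 -(pr_setC _ _ (mD t')) -(pair_rect _ _ _ mCt' mCt') -(pair_rotation n h h _ mR h0 h2).
apply: pr_mono; first exact: measurableU.
  by apply: measurable_preimage_rotation; exact: measurableX.
move=> [x y] [[/= Cx ny]|[/= nx Cy]]; split => /= D.
- by apply: ny; apply: (key x) => //; rewrite scalerDr.
- by apply: ny; apply: (key (- x)); [exact: symC|rewrite addrC scalerBr].
- by apply: nx; apply: (key y) => //; rewrite addrC scalerDr.
- apply: nx; apply: (key (- y)); first exact: symC.
  by rewrite addrC -opprB scalerN; apply: dilN => //; rewrite scalerBr.
Qed.

Definition tail_weight (t : nat -> R) (k : nat) : R :=
  if k is k'.+1 then 1 - g (dil C (t k')) else 1.

(* [y] is classified by the first [k] with [y \in t_k C]; [tail_weight] bounds the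
   probability of each class. *)
Lemma noise_step c s (t : nat -> R) L : 0 < c -> 0 < s -> c ^+ 2 + s ^+ 2 = 1 ->
  (forall k, 0 < t k) ->
  rho c s <= \sum_(k < L.+1) (tail_weight t k *
                             (g (dil C ((1 + s * t k) / c)) - g C))
             + (1 - g (dil C (t L))).
Proof.
move=> c0 s0 cs t0.
pose Y k : set 'rV[R]_n := if k is k'.+1 then ~` dil C (t k') else setT.
have mY k : measurable (Y k).
  by case: k => [|k] //=; apply: measurableC; exact: mD.
pose X k := dil C ((1 + s * t k) / c) `\` C.
have mX k : measurable (X k) by apply: measurableD => //; exact: mD.
have cs1 : c <= 1 by nra.
have lam1 k : 1 <= (1 + s * t k) / c.
  by rewrite ler_pdivlMr// mul1r (le_trans cs1)// lerDl mulr_ge0// ltW.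
pose B : set ('rV[R]_n * 'rV[R]_n) := [set p | C (c *: p.1 + (- s) *: p.2) /\ ~ C p.1].
have mB : measurable B.
  apply: measurableI; first exact: measurable_preimage_lin.
  by apply: measurableC; exact: measurable_preimage_fst.
have -> : rho c s = gg B.
  rewrite -(pair_rotation n c s)//; congr (pr _ _); apply/seteqP.
  have E (x y : 'rV[R]_n) : c *: (c *: x + s *: y) + - s *: (c *: y - s *: x) = x.
    rewrite -[RHS]scale1r -cs; apply/rowP => i; rewrite !mxE; ring.
  by split => -[x y]; rewrite /noise_set /B /= E.
have mZ : measurable ([set: 'rV[R]_n] `*` ~` dil C (t L)).
  by apply: measurableX => //; apply: measurableC; exact: mD.
have E : \sum_(k < L.+1) (tail_weight t k *
      (g (dil C ((1 + s * t k) / c)) - g C)) + (1 - g (dil C (t L))) =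
   \sum_(k < L.+1) gg (X k `*` Y k) + gg ([set: 'rV[R]_n] `*` ~` dil C (t L)).
  have gT : g setT = 1 by rewrite /pr probability_setT.
  congr (_ + _); last first.
    by rewrite pair_rect// ?gT ?mul1r ?pr_setC//; apply: measurableC; exact: mD.
  apply: eq_bigr => k _; rewrite pair_rect// mulrC pr_setD//; last first.
    by move=> x Cx; apply: (dil_mono C convC C0 1) => //; rewrite dil1.
  by congr (_ * _); case: (k : nat) => [|k'] /=; rewrite ?gT// pr_setC.
rewrite E.
have mXY k : measurable (X k `*` Y k) by exact: measurableX.
apply: (le_trans _ (lerD (pr_bigsetU_le _ _ _ mXY) (lexx _))).
apply: (le_trans _ (pr_setU_le _ _ _ _ mZ)); last exact: bigsetU_measurable.
apply: pr_mono => //; first by apply: measurableU => //; exact: bigsetU_measurable.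
move=> [x y] [/= Cxy nCx].
have [Dy|nDy] := pselect (dil C (t L) y); last by right.
left; rewrite -(bigcup_mkord L.+1 (fun k => X k `*` Y k)).
(* Go down from [L] until the preceding dilate no longer contains [y]; at index 0 the condition
   [Y 0] is vacuous. *)
have [k [kL Dk Yk]] : exists k, [/\ (k <= L)%N, dil C (t k) y & Y k y].
  move: Dy; elim: (L) => [|m IH] Dm; first by exists 0.
  have [/IH[k [km Dk Yk]]|nD] := pselect (dil C (t m) y).
    by exists k; split => //; exact: leq_trans km _.
  by exists m.+1.
exists k => //=; split => //; split => //=.
have -> : x = c^-1 *: ((c *: x + - s *: y) + s *: y).
  by rewrite scaleNr subrK scalerA mulVf ?gt_eqF// scale1r.
rewrite [X in dil C X]mulrC; apply: dilZ; first by rewrite invr_gt0.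
apply: (dilD C convC) => //; rewrite ?mulr_gt0 ?dil1//.
exact: dilZ.
Qed.

End noise.

(** The witnesses are the cosine and sine of [pi / 2^(k+2)], produced by the half-angle formulas.
    The tangent at least halves at each step, as [s' / c' = s / (1 + c)] and [c <= 1], while the
    lower bound on [f] loses exactly a factor 2. *)
Lemma half_angle (R : realType) (x : R) (f : R -> R -> R) :
  x <= f 0 1 ->
  (forall c s, 0 < c -> c ^+ 2 + s ^+ 2 = 1 ->
     f (c ^+ 2 - s ^+ 2) (2 * c * s) <= 2 * f c s) ->
  forall k, exists c s, [/\ 0 < c, 0 < s, c ^+ 2 + s ^+ 2 = 1,
    s / c <= 2 ^- k & x <= 2 ^+ k.+1 * f c s].
Proof.
move=> x01 dbl; elim=> [|k [c [s [c0 s0 cs sc xf]]]].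
  have [h [h0 h2]] : exists h : R, 0 < h /\ h ^+ 2 + h ^+ 2 = 1.
    exists (Num.sqrt 2)^-1; split; first by rewrite invr_gt0 sqrtr_gt0.
    by rewrite exprVn sqr_sqrtr//; field.
  exists h, h; split => //; first by rewrite divff ?gt_eqF// expr0 invr1.
  have hh : 2 * h * h = 1 by rewrite -[RHS]h2; ring.
  have := dbl h h h0 h2; rewrite subrr hh.
  by rewrite expr1; lra.
have c1 : c <= 1 by nra.
pose c' := Num.sqrt ((1 + c) / 2).
have cc : c' ^+ 2 = (1 + c) / 2 by rewrite sqr_sqrtr// divr_ge0//; lra.
have c'0 : 0 < c' by rewrite sqrtr_gt0 divr_gt0//; lra.
pose s' := s / (2 * c').
have s'0 : 0 < s' by rewrite divr_gt0// mulr_gt0.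
have ss : s' ^+ 2 = (1 - c) / 2.
  rewrite /s' expr_div_n exprMn cc.
  have -> : s ^+ 2 = 1 - c ^+ 2 by rewrite -cs; ring.
  by field; lra.
have e1 : 2 * c' * s' = s by rewrite /s'; field; rewrite gt_eqF.
have e2 : c' ^+ 2 - s' ^+ 2 = c by rewrite cc ss; field.
have cs' : c' ^+ 2 + s' ^+ 2 = 1 by rewrite cc ss; field.
exists c', s'; split => //.
- have -> : s' / c' = s / (1 + c).
    have -> : 1 + c = 2 * c' ^+ 2 by rewrite cc; field.
    by rewrite /s'; field; rewrite gt_eqF.
  apply: (le_trans (y := (s / c) / 2)); last first.
    by rewrite exprSr invfM ler_pM2r.
  rewrite -mulrA -invfM ler_pM2l// lef_pV2 ?posrE; lra.
- have := dbl c' s' c'0 cs'; rewrite e1 e2 => D.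
  apply: (le_trans xf); rewrite [in leRHS]exprSr -mulrA ler_pM2l//.
Qed.

(* Sum of the series [9 * 8192 * (9/32)^k], which dominates
   [tail_weight k * (radius k + 1)^2]. *)
Definition weight_bound (R : realType) : R := 9 * (8 * 1024) * (32 / 23).

(** * Lower bound on the growth rate of the dilates *)

Section lower_bound.
Context {R : realType} {n : nat} (C : set 'rV[R]_n).
Hypothesis mC : measurable C.
Hypothesis convC : forall x y a b, C x -> C y -> 0 <= a -> 0 <= b -> a + b = 1 ->
  C (a *: x + b *: y).
Hypothesis symC : forall x, C x -> C (- x).
Hypothesis C0 : C 0.
Notation g := (pr (@gauss R n)).
Hypothesis g_lo : 2 / 5 <= g C.
Hypothesis g_hi : g C <= 3 / 5.

(* The solution of [t_0 = 1], [t_(k+1) = 1 + 3/2 t_k], where [3/2 >= sqrt 2]. *)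
Definition radius (k : nat) : R := 3 * (3 / 2) ^+ k - 2.

Let radius_ge1 k : 1 <= radius k.
Proof.
rewrite /radius; have : 1 <= (3 / 2) ^+ k :> R; last lra.
by apply: exprn_ege1; lra.
Qed.

Let radiusS k : radius k.+1 = 1 + 3 / 2 * radius k.
Proof. by rewrite /radius exprS; field. Qed.

Let tail k := 1 - g (dil C (radius k)).

Let tail_ge0 k : 0 <= tail k.
Proof. by rewrite subr_ge0 pr_le1//; exact: measurable_dil. Qed.

Let tailS k : 2 * g C * tail k.+1 <= tail k ^+ 2.
Proof.
apply: fernique => //; first exact: lt_le_trans (radius_ge1 k).
by rewrite radiusS.
Qed.

(** Normalized by [2 g(C)], the Fernique inequality reads [r (k+1) <= (r k)^2], and
    [r 0 <= (3/5) / (4/5) = 3/4]. Three squarings bring [r] below [1/8], after which each step gains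
    at least a factor 8. The constant is [8^3] for the three lost steps, times 2 to cover
    [2 g(C) <= 6/5]. A geometric rate suffices because the squared radii grow only like
    [(9/4)^k]. *)
Lemma tail_decay k : tail k <= 1024 * 8 ^- k.
Proof.
pose r k := tail k / (2 * g C).
have g0 : 0 < 2 * g C by move: g_lo; lra.
have r0 j : 0 <= r j by rewrite divr_ge0// ltW.
have rS j : r j.+1 <= r j ^+ 2.
  rewrite /r expr_div_n expr2 [leRHS](_ : _ = tail j ^+ 2 / (2 * g C) / (2 * g C)).
    rewrite ler_pM2r ?invr_gt0// ler_pdivlMr// mulrC; exact: tailS.
  by rewrite invfM mulrA -expr2.
have r00 : r 0 <= 3 / 4.
  rewrite /r /tail (_ : radius 0 = 1); last by rewrite /radius expr0; ring.
  by rewrite dil1 ler_pdivrMr//; move: g_lo; lra.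
have r1 : r 1 <= 9 / 16 by have := rS 0; have := r0 0; nra.
have r2 : r 2 <= 81 / 256 by have := rS 1; have := r0 1; nra.
have r3 j : r (3 + j)%N <= 1 / 8 by elim: j => [|j IH]; [have := rS 2; have := r0 2; nra|have := rS (3 + j)%N; have := r0 (3 + j)%N; rewrite addnS; nra].
have r3' j : r (3 + j)%N <= 8 ^- j.
  elim: j => [|j IH]; first by rewrite expr0 invr1 (le_trans (r3 0))//; lra.
  rewrite addnS exprSr invfM (le_trans (rS _))// expr2 ler_pM//.
  by have := r3 j; lra.
have rk : r k <= 512 * 8 ^- k.
  have p8 j : 0 < 8 ^+ j :> R by rewrite exprn_gt0.
  case: k => [|[|[|k]]].
  - by rewrite expr0 invr1; lra.
  - by rewrite expr1; lra.
  - by rewrite expr2; lra.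
  - have -> : 512 * 8 ^- k.+3 = 8 ^- k :> R.
      by rewrite !exprSr; field; rewrite gt_eqF.
    exact: r3'.
have -> : tail k = 2 * g C * r k by rewrite /r; field; move: g_lo; lra.
have p8 : 0 <= 8 ^- k :> R by rewrite invr_ge0 exprn_ge0.
move: g_hi rk (r0 k); set u := r k; set v := 8 ^- k in p8 *; nra.
Qed.


Let M : R := weight_bound R.

Lemma sum_weights_le L :
  \sum_(k < L) tail_weight C radius k * (radius k + 1) ^+ 2 <= M.
Proof.
have q k : tail_weight C radius k * (radius k + 1) ^+ 2 <= 9 * (8 * 1024) * (9 / 32) ^+ k.
  (* The extra factor 8 pays for the shift of index in [tail_weight]. *)
  have t1 : tail_weight C radius k <= (8 * 1024) * 8 ^- k.
    case: k => [|k] /=; first by rewrite expr0; lra.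
    apply: (le_trans (tail_decay k)).
    have : 0 <= 8 ^- k :> R by rewrite invr_ge0 exprn_ge0.
    by rewrite exprS invfM; lra.
  have t2 : (radius k + 1) ^+ 2 <= 9 * (9 / 4) ^+ k.
    have -> : 9 * (9 / 4) ^+ k = (3 * (3 / 2) ^+ k) ^+ 2 :> R.
      have -> : 9 / 4 = (3 / 2) ^+ 2 :> R by field.
      by rewrite [RHS]exprMn -[in LHS]exprM -[in RHS]exprM mulnC; congr (_ * _); ring.
    rewrite ler_pXn2r// ?nnegrE.
    - by rewrite /radius; lra.
    - by have := radius_ge1 k; lra.
    - by rewrite mulr_ge0// exprn_ge0//; lra.
  have t0 : 0 <= tail_weight C radius k by case: k {t1 t2} => [|k] //=; exact: tail_ge0.
  apply: (le_trans (ler_pM t0 _ t1 t2)); first exact: sqr_ge0.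
  have -> : (9 / 32) ^+ k = 8 ^- k * (9 / 4) ^+ k :> R.
    by rewrite -exprVn -exprMn; congr (_ ^+ _); field.
  lra.
apply: (@le_trans _ _ (\sum_(k < L) 9 * (8 * 1024) * (9 / 32) ^+ k)).
  by apply: ler_sum => k _; exact: q.
rewrite -mulr_sumr.
have -> : \sum_(i < L) (9 / 32) ^+ i = 32 / 23 * (1 - (9 / 32) ^+ L) :> R.
  elim: L => [|L IH]; first by rewrite big_ord0 expr0 subrr mulr0.
  by rewrite big_ord_recr/= IH exprS; field.
have : 0 <= (9 / 32) ^+ L :> R by rewrite exprn_ge0//; lra.
rewrite /M /weight_bound; lra.
Qed.

Let A := n%:R * g C - mass2 C.
Let K : R := n%:R ^+ 2 + 2 * n%:R.

Let growth e : 0 <= e -> g (dil C (1 + e)) - g C <= e * A + K * e ^+ 2.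
Proof.
apply: dil_growth => // l x l1 Cx; apply: (dil_mono C convC C0 1) => //.
by rewrite dil1.
Qed.

Let K_ge0 : 0 <= K. Proof. by rewrite addr_ge0 ?mulr_ge0 ?sqr_ge0. Qed.

(** The dilates increase with [e], so the right side of [growth] is nonnegative; divide by
    [e = 2^-k] and let it tend to 0. The sign is needed to multiply inequalities by [A] below. *)
Lemma growth_ge0 : 0 <= A.
Proof.
apply: (@le_geometric_limit _ _ _ K) => k.
have p0 : 0 < 2 ^- k :> R by rewrite invr_gt0 exprn_gt0.
have := growth _ (ltW p0).
have : 0 <= g (dil C (1 + 2 ^- k)) - g C.
  rewrite subr_ge0 pr_mono//; first exact: measurable_dil.
  by move=> x Cx; apply: (dil_mono C convC C0 1); rewrite ?dil1 ?lerDl ?ltW.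
move=> /le_trans/[apply].
set p := 2 ^- k in p0 *.
have -> : p * A + K * p ^+ 2 = p * (A + p * K) by ring.
by rewrite pmulr_rge0.
Qed.

(** [noise_step] combined with [growth], the truncation level [L] being sent to infinity. The
    dilation excess [e] for class [k] is at most [tau (radius k + 1)] with [tau = s / c], which
    separates the angle from the series of weights. *)
Lemma rho_le c s : 0 < c -> 0 < s -> c ^+ 2 + s ^+ 2 = 1 ->
  rho C c s <= s / c * (A * M) + (s / c) ^+ 2 * (K * M).
Proof.
move=> c0 s0 cs; apply: (@le_geometric_limit _ _ _ 1024) => L.
have ns := noise_step C mC convC C0 c s radius L c0 s0 cs
   (fun k => lt_le_trans ltr01 (radius_ge1 k)).
apply: (le_trans ns); apply: lerD; last first.
  apply: (le_trans (tail_decay L)); rewrite [leLHS]mulrC.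
  apply: ler_wpM2r; first exact: ler0n.
  rewrite lef_pV2 ?posrE ?exprn_gt0//.
  by rewrite lerXn2r// ?nnegrE//; lra.
pose w := tail_weight C radius.
have w0 k : 0 <= w k by case: k => [|k] //=; exact: tail_ge0.
set tau := s / c.
have tau0 : 0 < tau by rewrite divr_gt0.
have step k : w k * (g (dil C ((1 + s * radius k) / c)) - g C) <=
   (tau * A + tau ^+ 2 * K) * (w k * (radius k + 1) ^+ 2).
  have r1 := radius_ge1 k.
  set e := (1 + s * radius k) / c - 1.
  have ee : (1 + s * radius k) / c = 1 + e by rewrite /e; ring.
  have c1 : c <= 1 by nra.
  have e0 : 0 <= e.
    rewrite subr_ge0 ler_pdivlMr// mul1r (le_trans c1)// lerDl mulr_ge0 ?ltW//; lra.
  (* Uses [1 - c <= s], true for positive [c] and [s] on the unit circle. *)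
  have ele : e <= tau * (radius k + 1).
    have -> : e = (1 - c) / c + tau * radius k.
      by rewrite /e /tau; field; rewrite gt_eqF.
    rewrite [leRHS]mulrDr mulr1 addrC lerD2l /tau ler_pM2r ?invr_gt0//; nra.
  rewrite ee mulrCA ler_wpM2l//; apply: (le_trans (growth _ e0)).
  have A0 := growth_ge0.
  have e2 : e ^+ 2 <= tau ^+ 2 * (radius k + 1) ^+ 2.
    by rewrite -exprMn lerXn2r// nnegrE// mulr_ge0 ?ltW//; lra.
  (* Since [radius k + 1 >= 1], its square also dominates the first-order term, so the single bound
     [M] serves both orders. *)
  have h1 : e * A <= tau * A * (radius k + 1) ^+ 2.
    apply: (le_trans (ler_wpM2r A0 ele)).
    rewrite [leLHS]mulrAC; apply: ler_wpM2l; first by rewrite mulr_ge0// ltW.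
    by rewrite expr2 ler_peMl//; lra.
  have h2 : K * e ^+ 2 <= tau ^+ 2 * K * (radius k + 1) ^+ 2.
    by rewrite mulrAC mulrC ler_wpM2r.
  by rewrite [leRHS]mulrDl lerD.
apply: (@le_trans _ _ (\sum_(k < L.+1) (tau * A + tau ^+ 2 * K) * (w k * (radius k + 1) ^+ 2))).
  by apply: ler_sum => k _; exact: step.
rewrite -mulr_sumr.
have -> : tau * (A * M) + tau ^+ 2 * (K * M) = (tau * A + tau ^+ 2 * K) * M by ring.
rewrite ler_wpM2l ?sum_weights_le//.
apply: addr_ge0; apply: mulr_ge0;
  [exact: ltW|exact: growth_ge0|exact: sqr_ge0|exact: K_ge0].
Qed.

(** At an angle of tangent at most [2^-k], multiplying [rho_le] by [2^(k+1)] leaves [2 A M] and an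
    error [2^-k * 2 K M]. In the limit [K], the only term quadratic in [n], vanishes. The constant
    comes from [v (1 - v) >= 6/25] on [[2/5, 3/5]]. *)
Lemma growth_rate_lower : 3 / (25 * weight_bound R) <= A.
Proof.
have H : g C * (1 - g C) <= 2 * (A * M).
  apply: (@le_geometric_limit _ _ _ (2 * (K * M))) => k.
  have [] := half_angle _ (g C * (1 - g C)) (rho C) _ _ k.
  - by rewrite rho01.
  - by move=> c s; exact: rho_double.
  move=> c [s [c0 s0 cs sc xf]].
  apply: (le_trans xf).
  have p0 : 0 < 2 ^+ k :> R by rewrite exprn_gt0.
  have A0 := growth_ge0.
  have M0 : 0 <= M by rewrite /M /weight_bound; lra.
  have tau0 : 0 <= s / c by rewrite divr_ge0// ltW.
  have := rho_le _ _ c0 s0 cs; set tau := s / c in sc tau0 * => rl.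
  have s2 : tau ^+ 2 <= 2 ^- k * 2 ^- k by rewrite expr2 ler_pM.
  have : rho C c s <= 2 ^- k * (A * M) + 2 ^- k * 2 ^- k * (K * M).
    apply: (le_trans rl); apply: lerD; apply: ler_wpM2r => //;
      [exact: (mulr_ge0 A0 M0)|exact: (mulr_ge0 K_ge0 M0)].
  have p2 : 0 <= 2 ^+ k.+1 :> R by rewrite exprn_ge0.
  move=> /(ler_wpM2l p2) /le_trans; apply.
  rewrite le_eqVlt; apply/orP; left; apply/eqP.
  by rewrite exprS; field; rewrite gt_eqF.
have M0 : 0 < M by rewrite /M /weight_bound; lra.
have lo : 6 / 25 <= g C * (1 - g C) by move: g_lo g_hi; nra.
have M25 : 0 < 25 * M by apply: mulr_gt0 => //; lra.
have e : A * (25 * M) = 25 * (A * M) := mulrCA _ _ _.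
rewrite -/M (ler_pdivrMr _ _ M25) e.
by move: H lo; set u := A * M; set v := g C * (1 - g C); clearbody u v; lra.
Qed.

End lower_bound.

(** * Closure and slices of a convex set *)

(** Closure for the sup norm, written in coordinates so that slicing and rational approximation
    apply directly. *)
Definition clo {R : realType} {n : nat} (K : set 'rV[R]_n) : set 'rV[R]_n :=
  [set x | forall e, 0 < e -> exists2 y, K y & forall i, `|x ord0 i - y ord0 i| < e].

Definition cvx {R : realType} {n : nat} (K : set 'rV[R]_n) : Prop :=
  forall x y a b, K x -> K y -> 0 <= a -> 0 <= b -> a + b = 1 -> K (a *: x + b *: y).

Definition slice {R : realType} {n : nat} (K : set 'rV[R]_n.+1) (t : R) : set 'rV[R]_n :=
  [set v | K (rvcons (t, v))].

Section closure.
Context {R : realType}.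

Lemma convex_set_cvx n (K : set 'rV[R]_n) : convex_set K -> cvx K.
Proof.
move=> cK x y a b Kx Ky a0 b0 ab.
have a1 : a <= 1 by lra.
have := cK x y (Itv01 a0 a1); rewrite !inE => /(_ Kx Ky).
by congr K; rewrite /conv/=; congr (_ + _ *: _); rewrite -[LHS]/(1 - a); lra.
Qed.

Lemma sub_clo n (K : set 'rV[R]_n) : K `<=` clo K.
Proof. by move=> x Kx e e0; exists x => // i; rewrite subrr normr0. Qed.

Lemma clo_cvx n (K : set 'rV[R]_n) : cvx K -> cvx (clo K).
Proof.
move=> cK x y a b Kx Ky a0 b0 ab e e0.
have [x' Kx' xx'] := Kx _ e0; have [y' Ky' yy'] := Ky _ e0.
exists (a *: x' + b *: y'); first exact: cK.
move=> i; rewrite !mxE.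
have -> : a * x ord0 i + b * y ord0 i - (a * x' ord0 i + b * y' ord0 i) =
  a * (x ord0 i - x' ord0 i) + b * (y ord0 i - y' ord0 i) by ring.
apply: (le_lt_trans (ler_normD _ _)).
rewrite !normrM (ger0_norm a0) (ger0_norm b0).
have := xx' i; have := yy' i.
set u := `|_|; set v := `|_| => ue ve.
have [a00|a00] := eqVneq a 0.
  by have b1 : b = 1 by [lra]; rewrite a00 b1; lra.
have ap : 0 < a by rewrite lt_neqAle eq_sym a00.
have : a * v < a * e by rewrite ltr_pM2l.
have : b * u <= b * e by rewrite ler_wpM2l// ltW.
have : a * e + b * e = e by rewrite -mulrDl ab mul1r.
lra.
Qed.

Lemma clo_sym n (K : set 'rV[R]_n) : (forall x, K x -> K (- x)) ->
  forall x, clo K x -> clo K (- x).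
Proof.
move=> sK x Kx e e0; have [y Ky xy] := Kx e e0.
exists (- y); first exact: sK.
by move=> i; rewrite !mxE -opprD normrN; exact: xy.
Qed.

(** The sigma-algebra is generated by coordinates, so the closure is exhibited as a countable
    intersection of countable unions of cubes with rational centres. *)
Lemma measurable_clo n (K : set 'rV[R]_n) : measurable (clo K).
Proof.
pose B (m : nat) (q : 'rV[rat]_n) : set 'rV[R]_n :=
  [set x | forall i, `|x ord0 i - ratr (q ord0 i)| < m.+1%:R^-1].
have mB m q : measurable (B m q).
  have -> : B m q = \bigcap_(i in [set: 'I_n]) ((fun x : 'rV[R]_n => x ord0 i) @^-1`
      `]ratr (q ord0 i) - m.+1%:R^-1, ratr (q ord0 i) + m.+1%:R^-1[).
    apply/seteqP; split => x Bx i /=.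
      by move=> _; have := Bx i; rewrite in_itv/= ltr_distl.
    by have := Bx i I; rewrite /= in_itv/= ltr_distl.
  apply: fin_bigcap_measurable; first exact: finite_finset.
  move=> i _; rewrite -[X in measurable X]setTI; apply: measurable_coord => //.
pose near m q := exists2 y, K y & B m q y.
have -> : clo K = \bigcap_m \bigcup_(q in [set q | near m q]) B m q.
  apply/seteqP; split => x.
    move=> Kx m _.
    (* Half the radius of the cube: the rational centre must be close to [x] and also to the point
       [y] of [K] near [x]. *)
    pose d : R := m.+1%:R^-1 / 2.
    have d0 : 0 < d by rewrite divr_gt0// invr_gt0.
    have [y Ky xy] := Kx d d0.
    have q i : {r : rat | `|x ord0 i - ratr r| < d}.
      apply: cid; have /rat_in_itvoo[r] : x ord0 i - d < x ord0 i + d by lra.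
      rewrite in_itv/= => /andP[r1 r2]; exists r.
      by rewrite ltr_norml; apply/andP; split; lra.
    exists (\row_i sval (q i)).
      exists y => // i; rewrite mxE; have := svalP (q i); have := xy i.
      have -> : y ord0 i - ratr (sval (q i)) =
        - (x ord0 i - y ord0 i) + (x ord0 i - ratr (sval (q i))) by ring.
      move=> u v; apply: (le_lt_trans (ler_normD _ _)); rewrite normrN.
      by have -> : m.+1%:R^-1 = d + d by [rewrite /d; field]; exact: ltrD.
    move=> i; rewrite mxE; have := svalP (q i).
    by have -> : m.+1%:R^-1 = d + d by [rewrite /d; field]; move: d0; lra.
  move=> H e e0; pose m := Num.bound (2 / e).
  have me : 2 / m.+1%:R < e.
    rewrite ltr_pdivrMr// mulrC -ltr_pdivrMr//.
    apply: (lt_trans (archi_boundP _)); first by rewrite divr_ge0// ltW.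
    by rewrite ltr_nat.
  have [q [y Ky yq] xq] := H m I.
  exists y => // i; have := xq i; have := yq i => u v.
  have -> : x ord0 i - y ord0 i = (x ord0 i - ratr (q ord0 i)) - (y ord0 i - ratr (q ord0 i)) by ring.
  apply: (le_lt_trans (ler_normB _ _)); apply: lt_trans me.
  by have -> : 2 / m.+1%:R = m.+1%:R^-1 + m.+1%:R^-1 :> R by [ring]; exact: ltrD.
apply: bigcapT_measurable => m; rewrite bigcup_mkcond.
apply: countable_bigcupT_measurable => [|q]; first exact: countableP.
by case: ifP.
Qed.

Lemma slice_cvx n (K : set 'rV[R]_n.+1) t : cvx K -> cvx (slice K t).
Proof.
move=> cK x y a b Kx Ky a0 b0 ab; rewrite /slice/=.
have -> : rvcons (t, a *: x + b *: y) = a *: rvcons (t, x) + b *: rvcons (t, y).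
  by rewrite !rvconsZ rvconsD -mulrDl ab mul1r.
exact: cK.
Qed.

Lemma clo_slice_sub n (K : set 'rV[R]_n.+1) t : clo (slice K t) `<=` slice (clo K) t.
Proof.
move=> v Kv e e0; have [w Kw vw] := Kv e e0.
exists (rvcons (t, w)) => // i.
case: (unliftP ord0 i) => [j|] ->; first by rewrite !rvconsS; exact: vw.
by rewrite !rvcons0 subrr normr0.
Qed.

(* A point of [K] on the far side of [t] lets one push an approximant of [(t, v)]
   back into the slice at [t]. *)
Lemma slice_clo_sub n (K : set 'rV[R]_n.+1) t : cvx K ->
  (exists t1 v1, t1 < t /\ K (rvcons (t1, v1))) ->
  (exists t2 v2, t < t2 /\ K (rvcons (t2, v2))) ->
  slice (clo K) t `<=` clo (slice K t).
Proof.
move=> cK [t1 [v1 [t1t K1]]] [t2 [v2 [tt2 K2]]] v Kv.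
move=> e e0.
have push u w : u != t -> K (rvcons (u, w)) -> exists2 d, 0 < d & forall s z,
    K (rvcons (s, z)) -> `|t - s| < d -> (forall i, `|v ord0 i - z ord0 i| < d) ->
    (s - t) * (u - t) <= 0 ->
    exists2 y, slice K t y & forall i, `|v ord0 i - y ord0 i| < e.
  move=> ut Kw.
  pose m := `|u - t|.
  have m0 : 0 < m by rewrite normr_gt0 subr_eq0.
  pose M : R := \sum_i `|w ord0 i - v ord0 i|.
  have M0 : 0 <= M by exact: sumr_ge0.
  (* Chosen so that [d + (d / m) M = e]: the first term is the error of the approximant, the second
     the displacement towards [w]. *)
  pose d := e / (1 + M / m).
  have dm : 0 < 1 + M / m by rewrite ltr_pwDl// divr_ge0// ltW.
  have d0 : 0 < d by rewrite divr_gt0.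
  exists d => // s z Kz ts vz st.
  (* The weight at which the segment from [(s, z)] to [(u, w)] meets the hyperplane at [t], as [s]
     and [u] lie on opposite sides of [t]. Absolute values cover both orientations, and [s = t]
     gives weight 0. *)
  pose th := `|t - s| / (`|t - s| + m).
  have den : 0 < `|t - s| + m by rewrite ltr_wpDl.
  have th0 : 0 <= th by rewrite divr_ge0// ltW.
  have th1 : th <= 1 by rewrite ler_pdivrMr// mul1r lerDl ltW.
  have thm : th <= `|t - s| / m by rewrite ler_wpM2l// lef_pV2 ?posrE// lerDr.
  have teq : (1 - th) * s + th * u = t.
    have -> : (1 - th) * s + th * u = s + th * (u - s) by ring.
    suff : th * (u - s) = t - s by move=> ->; ring.
    have [ut0|ut0] := ltrP t u.
      have st0 : s <= t by rewrite -subr_le0 -(pmulr_lle0 _ (x := u - t))// subr_gt0.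
      rewrite /th /m !ger0_norm ?subr_ge0// ?(ltW ut0)//; field.
      by rewrite gt_eqF//; lra.
    have ut1 : u < t by rewrite lt_neqAle ut.
    have st0 : t <= s by rewrite -subr_ge0 -(nmulr_lle0 _ (x := u - t))// subr_lt0.
    rewrite /th /m !ler0_norm ?subr_le0//; field.
    by rewrite gt_eqF//; lra.
  clearbody th; exists ((1 - th) *: z + th *: w).
    rewrite /slice/= -[in rvcons (t, _)]teq -rvconsD -!rvconsZ.
    by apply: cK => //; lra.
  move=> i; rewrite !mxE.
  have -> : v ord0 i - ((1 - th) * z ord0 i + th * w ord0 i) =
     (1 - th) * (v ord0 i - z ord0 i) - th * (w ord0 i - v ord0 i) by ring.
  apply: (le_lt_trans (ler_normB _ _)); rewrite !normrM (ger0_norm th0).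
  rewrite (ger0_norm (_ : 0 <= 1 - th)); last by lra.
  have wM : `|w ord0 i - v ord0 i| <= M.
    by rewrite /M (bigD1 i)//= lerDl sumr_ge0.
  have h1 : (1 - th) * `|v ord0 i - z ord0 i| <= `|v ord0 i - z ord0 i|.
    by rewrite ler_piMl//; lra.
  have h2 : th * `|w ord0 i - v ord0 i| <= d / m * M.
    apply: ler_pM => //; apply: (le_trans thm).
    by rewrite ler_pM2r ?invr_gt0// ltW.
  have h3 : d + d / m * M = e.
    have -> : d + d / m * M = d * (1 + M / m) by ring.
    by rewrite /d divfK// gt_eqF.
  have := vz i; lra.
have [d1 d10 H1] := push t1 v1 (negbT (lt_eqF t1t)) K1.
have [d2 d20 H2] := push t2 v2 (negbT (gt_eqF tt2)) K2.
have d0 : 0 < Num.min d1 d2 by rewrite lt_min d10.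
have [x Kx vx] := Kv _ d0.
have [[s z] xE] := rvcons_inj n x.
rewrite {}xE in Kx vx.
have ts : `|t - s| < Num.min d1 d2 by have := vx ord0; rewrite !rvcons0.
have vz i : `|v ord0 i - z ord0 i| < Num.min d1 d2.
  by have := vx (lift ord0 i); rewrite !rvconsS.
have [st|/ltW st] := leP s t.
  apply: (H2 s z Kx).
  - by move: ts; rewrite lt_min => /andP[].
  - by move=> i; have := vz i; rewrite lt_min => /andP[].
  - by rewrite mulr_le0_ge0 ?subr_le0// subr_ge0 ltW.
apply: (H1 s z Kx).
- by move: ts; rewrite lt_min => /andP[].
- by move=> i; have := vz i; rewrite lt_min => /andP[].
- by rewrite mulr_ge0_le0 ?subr_ge0// subr_le0 ltW.
Qed.

(* The exceptional values are the endpoints of the projection of [K]. *)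
Lemma clo_sliceE n (K : set 'rV[R]_n.+1) : cvx K ->
  exists a b, forall t, t != a -> t != b -> clo (slice K t) = slice (clo K) t.
Proof.
move=> cK.
pose P := [set t | exists v, K (rvcons (t, v))].
pose adh t := forall e, 0 < e -> exists2 s, P s & `|t - s| < e.
pose lo := [set t | adh t /\ forall s, P s -> t <= s].
pose hi := [set t | adh t /\ forall s, P s -> s <= t].
have lo1 t u : lo t -> lo u -> t = u.
  move=> [at_ tl] [au ul]; apply/eqP; rewrite eq_le; apply/andP.
  by split; rewrite leNgt; apply/negP => tu;
    [have [|s Ps] := au (t - u) | have [|s Ps] := at_ (u - t)]; rewrite ?subr_gt0//;
    [have := tl s Ps|have := ul s Ps]; rewrite ltr_norml => ? /andP[? ?]; lra.
have hi1 t u : hi t -> hi u -> t = u.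
  move=> [at_ tl] [au ul]; apply/eqP; rewrite eq_le; apply/andP.
  by split; rewrite leNgt; apply/negP => tu;
    [have [|s Ps] := at_ (t - u) | have [|s Ps] := au (u - t)]; rewrite ?subr_gt0//;
    [have := ul s Ps|have := tl s Ps]; rewrite ltr_norml => ? /andP[? ?]; lra.
(* Each of [lo] and [hi] has at most one element; when one is empty the default 0 merely excludes
   one more value of [t]. *)
exists (xget 0 lo), (xget 0 hi) => t ta tb.
apply/seteqP; split; first exact: clo_slice_sub.
have [at_|nat_] := pselect (adh t); last first.
  move=> v Kv; exfalso; apply: nat_ => e e0.
  have [x Kx vx] := Kv e e0; have [[s z] xE] := rvcons_inj n x.
  rewrite {}xE in Kx vx.
  by exists s; [exists z|have := vx ord0; rewrite !rvcons0].
have nlo : ~ lo t.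
  move=> lt; move/eqP: ta; apply; case: xgetP => [x _ lx|/(_ t)//].
  exact: lo1.
have nhi : ~ hi t.
  move=> lt; move/eqP: tb; apply; case: xgetP => [x _ lx|/(_ t)//].
  exact: hi1.
apply: slice_clo_sub => //.
  apply: contrapT => H; apply: nlo; split => // s [w Kw].
  by rewrite leNgt; apply/negP => st; apply: H; exists s, w.
apply: contrapT => H; apply: nhi; split => // s [w Kw].
by rewrite leNgt; apply/negP => st; apply: H; exists s, w.
Qed.


End closure.

(** * Iterated integrals and Hermite coefficients *)

Section link.
Context {R : realType}.
Local Notation leb := (@lebesgue_measure R).
Local Notation pdf := (normal_pdf (0:R) 1).

Lemma integral_std (f : R -> \bar R) : measurable_fun setT f ->
  (\int[std]_x f x = \int[leb]_x (f x * (pdf x)%:E))%E.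
Proof.
move=> mf; have p0 x : 0 <= pdf x by exact: normal_pdf_ge0.
rewrite integralE [RHS]integralE; congr (_ - _)%E.
  rewrite ge0_integral_std//; last exact: measurable_funepos.
  apply: eq_integral => x _.
  have /(congr1 (fun k => k x)) := ge0_funeposM f (p0 x).
  by rewrite !funeposE /= !(muleC (f x)) => ->; rewrite muleC.
rewrite ge0_integral_std//; last exact: measurable_funeneg.
apply: eq_integral => x _.
have /(congr1 (fun k => k x)) := ge0_funenegM f (p0 x).
by rewrite !funenegE /= !(muleC (f x)) => ->; rewrite muleC.
Qed.

Lemma set_signE n (C : set 'rV[R]_n) x : set_sign C x = 2 * \1_C x - 1.
Proof.
rewrite /set_sign indicE.
have -> : (x \in C) = `[< C x >] by [].
by case: asboolP => _ /=; ring.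
Qed.

Lemma measurable_set_sign n (C : set 'rV[R]_n) : measurable C ->
  measurable_fun setT (set_sign C).
Proof.
move=> mC; rewrite (funext (set_signE n C)).
by apply: measurable_funB => //; apply: measurable_funM.
Qed.

Lemma normr_set_sign n (C : set 'rV[R]_n) x : `|set_sign C x| = 1.
Proof. by rewrite /set_sign; case: ifP => _; rewrite ?normrN normr1. Qed.

Definition prodf n (h : 'I_n -> R -> R) (x : 'rV[R]_n) : R := \prod_i h i (x ord0 i).

Lemma measurable_prodf n (h : 'I_n -> R -> R) : (forall i, measurable_fun setT (h i)) ->
  measurable_fun setT (prodf n h).
Proof.
move=> mh; apply: measurable_prod => i _.
exact: (measurableT_comp (mh i) (measurable_coord i)).
Qed.

Lemma prodf_rvcons n (h : 'I_n.+1 -> R -> R) t v :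
  prodf n.+1 h (rvcons (t, v)) = h ord0 t * prodf n (fun j => h (lift ord0 j)) v.
Proof.
rewrite /prodf big_ord_recl rvcons0; congr (_ * _).
by apply: eq_bigr => j _; rewrite rvconsS.
Qed.

Lemma prodf_lty n (h : 'I_n -> R -> R) : (forall i, measurable_fun setT (h i)) ->
  (forall i, \int[std]_t (`|h i t|)%:E < +oo)%E ->
  (\int[gauss n]_x (`|prodf n h x|)%:E < +oo)%E.
Proof.
elim: n h => [|n IH] h mh ih.
  rewrite ge0_integral_gauss0//; first exact: ltry.
  by apply/measurable_EFinP; apply: measurableT_comp => //; exact: measurable_prodf.
have mp m (k : 'I_m -> R -> R) : (forall i, measurable_fun setT (k i)) ->
    measurable_fun setT (fun x => (`|prodf m k x|)%:E).
  by move=> mk; apply/measurable_EFinP; apply: measurableT_comp => //; exact: measurable_prodf.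
rewrite ge0_integral_gaussS//; last exact: mp.
pose k j := h (lift ord0 j).
pose c := (\int[gauss n]_v (`|prodf n k v|)%:E)%E.
have mh0 : measurable_fun setT (fun t => (`|h ord0 t|)%:E).
  by apply/measurable_EFinP; exact: measurableT_comp.
have -> : (\int[std]_t \int[gauss n]_v (`|prodf n.+1 h (rvcons (t, v))|)%:E =
    \int[std]_t ((`|h ord0 t|)%:E * c))%E.
  apply: eq_integral => t _; rewrite -ge0_integralZl//.
    by apply: eq_integral => v _; rewrite prodf_rvcons normrM.
  by apply: mp => j; exact: mh.
have c0 : (0 <= c)%E by exact: integral_ge0.
have clt : (c < +oo)%E by apply: IH => j; [exact: mh|exact: ih].
rewrite ge0_integralZr//.
by apply: lte_mul_pinfty => //; [exact: integral_ge0|rewrite ge0_fin_numE//; exact: integral_ge0].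
Qed.

(** The scalar [a] makes this class stable under slicing: fixing the first coordinate at [t]
    multiplies it by [h ord0 t]. *)
Definition signed n (C : set 'rV[R]_n) (a : R) (h : 'I_n -> R -> R) (x : 'rV[R]_n) : R :=
  a * set_sign C x * prodf n h x.

Lemma measurable_signed n C a h : measurable C -> (forall i, measurable_fun setT (h i)) ->
  measurable_fun setT (signed n C a h).
Proof.
move=> mC mh; apply: measurable_funM; last exact: measurable_prodf.
by apply: measurable_funM => //; exact: measurable_set_sign.
Qed.

Lemma integrable_signed n C a (h : 'I_n -> R -> R) : measurable C ->
  (forall i, measurable_fun setT (h i)) ->
  (forall i, \int[std]_t (`|h i t|)%:E < +oo)%E ->
  (gauss n).-integrable setT (fun x => (signed n C a h x)%:E).
Proof.
move=> mC mh ih; apply/integrableP; split.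
  by apply/measurable_EFinP; exact: measurable_signed.
have mp : measurable_fun setT (fun x => (`|prodf n h x|)%:E).
  by apply/measurable_EFinP; apply: measurableT_comp => //; exact: measurable_prodf.
have -> : (\int[gauss n]_x `|(signed n C a h x)%:E| =
   (`|a|)%:E * \int[gauss n]_x (`|prodf n h x|)%:E)%E.
  rewrite -ge0_integralZl//; apply: eq_integral => x _.
  by rewrite /= /signed !normrM normr_set_sign mulr1.
by apply: lte_mul_pinfty => //; exact: prodf_lty.
Qed.

(** Applied to the inner iterated integral of [K], known only to agree with a measurable function
    off two points. *)
Lemma measurable_fun_eq_off2 (f f' : R -> R) (a b : R) :
  (forall t, t != a -> t != b -> f t = f' t) ->
  measurable_fun setT f' -> measurable_fun setT f.
Proof.
move=> ff' mf'.
have -> : f = (fun t => if t == a then f a else if t == b then f b else f' t).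
  apply/funext => t; have [->//|ta] := eqVneq t a.
  by have [->//|tb] := eqVneq t b; exact: ff'.
have meq (c : R) : measurable_fun setT (fun t : R => t == c).
  by apply: measurable_fun_eqr.
by apply: measurable_fun_ifT => //; apply: measurable_fun_ifT.
Qed.

Lemma integral_leb_eq_off2 (f f' : R -> R) (a b : R) :
  (forall t, t != a -> t != b -> f t = f' t) -> measurable_fun setT f' ->
  (\int[leb]_t (f t)%:E = \int[leb]_t (f' t)%:E)%E.
Proof.
move=> ff' mf'; have mf := measurable_fun_eq_off2 _ _ _ _ ff' mf'.
apply: ae_eq_integral => //; [exact/measurable_EFinP|exact/measurable_EFinP|].
exists ([set a] `|` [set b]); split.
- by apply: measurableU; exact: measurable_set1.
- apply/eqP; rewrite -measure_le0; apply: (le_trans (measureU2 _ _ _)) => //.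
    by rewrite [X in (X + _)%E](lebesgue_measure_set1 a) [X in (_ + X)%E](lebesgue_measure_set1 b) adde0.
- move=> t /= /not_implyP[_ /eqP nf]; apply: contrapT => /not_orP[/eqP ta /eqP tb].
  by move/eqP: nf; apply; rewrite ff'.
Qed.

(** Induction on the dimension. The induction hypothesis turns the inner iterated integral over a
    slice of [K] into an integral over the closure of that slice; by [clo_sliceE] this is the slice
    of [clo K] except at two values of [t], which the outer integral ignores, and Fubini reassembles
    the integral over [clo K]. *)
Lemma gauss_expect_sign n (K : set 'rV[R]_n) a (h : 'I_n -> R -> R) : cvx K ->
  (forall i, measurable_fun setT (h i)) ->
  (forall i, \int[std]_t (`|h i t|)%:E < +oo)%E ->
  ((gauss_expect (fun x => a * set_sign K x * prodf n h x))%:E =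
   \int[gauss n]_x (signed n (clo K) a h x)%:E)%E.
Proof.
elim: n K a h => [|n IH] K a h cK mh ih.
  have mS := measurable_signed _ _ a h (measurable_clo _ K) mh.
  rewrite integral_dirac//=; last exact/measurable_EFinP.
  rewrite diracT mul1e /signed; congr (_ * _ * _)%:E.
  have K0 : clo K = K.
    apply/seteqP; split; last exact: sub_clo.
    move=> x /(_ 1 ltr01)[y Ky _]; have -> // : x = y by apply/rowP => -[].
  by rewrite K0.
pose k j := h (lift ord0 j).
have mk j : measurable_fun setT (k j) by exact: mh.
have ik j : (\int[std]_t (`|k j t|)%:E < +oo)%E by exact: ih.
pose F := signed n.+1 (clo K) a h.
have mF : measurable_fun setT F by apply: measurable_signed => //; exact: measurable_clo.
have iF : (gauss n.+1).-integrable setT (EFin \o F).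
  by apply: integrable_signed => //; exact: measurable_clo.
pose Phi t := gauss_expect (fun v => a * set_sign K (rvcons (t, v)) * prodf n.+1 h (rvcons (t, v))).
have PhiE t : (Phi t)%:E =
    (\int[gauss n]_v (signed n (clo (slice K t)) (a * h ord0 t) k v)%:E)%E.
  rewrite -IH//; last exact: slice_cvx.
  congr (gauss_expect _)%:E; apply/funext => v.
  rewrite prodf_rvcons -/k /set_sign/slice/= mulrA; congr (_ * _).
  by rewrite mulrAC.
pose Psi t := fine (\int[gauss n]_v (F (rvcons (t, v)))%:E).
have PsiE t : (Psi t)%:E = (\int[gauss n]_v (F (rvcons (t, v)))%:E)%E.
  rewrite fineK//.
  have -> : (\int[gauss n]_v (F (rvcons (t, v)))%:E =
     \int[gauss n]_v (signed n (slice (clo K) t) (a * h ord0 t) k v)%:E)%E.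
    apply: eq_integral => v _; rewrite /F /signed prodf_rvcons -/k mulrA; congr (_ * _)%:E.
    by rewrite mulrAC.
  apply: integrable_fin_num => //; apply: integrable_signed => //.
  rewrite -[X in measurable X]setTI.
  exact: (measurableT_comp (@measurable_rvcons R n) (pair1_measurable t)) (measurable_clo _ K).
have [u [w uw]] := clo_sliceE _ _ cK.
have PP t : t != u -> t != w -> pdf t * Phi t = pdf t * Psi t.
  move=> tu tw; congr (_ * _); apply: EFin_inj; rewrite PhiE PsiE uw//.
  apply: eq_integral => v _; rewrite /F /signed prodf_rvcons -/k mulrA; congr (_ * _)%:E.
  by rewrite mulrAC.
have mFr : measurable_fun setT (fun p : R * 'rV[R]_n => (F (rvcons p))%:E).
  by apply/measurable_EFinP; exact: (measurableT_comp mF (@measurable_rvcons R n)).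
have iFr : (std \x gauss n)%E.-integrable setT (fun p : R * 'rV[R]_n => (F (rvcons p))%:E).
  apply/integrableP; split => //.
  move/integrableP : iF => [_]; apply: le_lt_trans.
  have mFa : measurable_fun setT (fun x => `|(F x)%:E|%E).
    by apply: measurableT_comp => //; exact/measurable_EFinP.
  by rewrite [leRHS](ge0_integral_distribution _ mFa).
have mPsi : measurable_fun setT Psi.
  apply/measurable_EFinP.
  rewrite (_ : EFin \o Psi = fubini_F (gauss n) (fun p : R * 'rV[R]_n => (F (rvcons p))%:E)).
    exact: measurable_fubini_F iFr.
  by apply/funext => t; rewrite /= PsiE.
have intPsi : (\int[leb]_t (pdf t * Psi t)%:E = \int[gauss n.+1]_x (F x)%:E)%E.
  transitivity (\int[std]_t (Psi t)%:E)%E.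
    rewrite integral_std; last exact/measurable_EFinP.
    by apply: eq_integral => t _; rewrite -EFinM mulrC.
  rewrite [RHS]integral_distribution//; last exact/measurable_EFinP.
  rewrite -[RHS](integral12_prod_meas1 iFr).
  by apply: eq_integral => t _; rewrite PsiE.
rewrite -intPsi -[LHS]/((Rintegral leb setT (fun t => pdf t * Phi t))%:E) /Rintegral.
rewrite (integral_leb_eq_off2 _ _ _ _ PP).
  by rewrite fineK// intPsi; exact: integrable_fin_num.
by apply: measurable_funM => //; exact: measurable_normal_pdf.
Qed.

End link.

(** * Hermite coefficients of degrees 0 and 2 *)

Section coefficients.
Context {R : realType}.

Lemma hermite0 (x : R) : hermite 0%N x = 1.
Proof. by rewrite /hermite /He/= fact0 sqrtr1 divr1. Qed.

Lemma hermite2 (x : R) : hermite 2%N x = (x ^+ 2 - 1) / Num.sqrt 2.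
Proof.
rewrite /hermite /He/= (_ : 2`! = 2)//; congr (_ / _).
by rewrite expr2 mul1r.
Qed.

Lemma measurable_hermite02 k : k = 0%N \/ k = 2%N -> measurable_fun setT (@hermite R k).
Proof.
move=> [->|->].
  by rewrite (funext hermite0); exact: measurable_cst.
rewrite (funext hermite2); apply: measurable_funM => //.
by apply: measurable_funB => //; exact: measurable_funX.
Qed.

Lemma integral_hermite02_lty k : k = 0%N \/ k = 2%N ->
  (\int[std]_(t in [set: R]) (`|hermite k t|)%:E < +oo)%E.
Proof.
move=> [->|->].
  rewrite (eq_integral (fun=> 1%E)); last by move=> t _; rewrite hermite0 normr1.
  by rewrite integral_cst_prob ltry.
apply: (@le_lt_trans _ _ (\int[std]_(t in [set: R]) ((t ^+ 2)%:E + 1))%E).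
  apply: ge0_le_integral => //.
  - apply/measurable_EFinP; apply: measurableT_comp => //.
    by apply: measurable_hermite02; right.
  - by apply: emeasurable_funD => //; exact: measurable_EFin_sqr.
  - move=> t _; rewrite -EFinD lee_fin hermite2 normrM.
    have s1 : 1 <= Num.sqrt 2 :> R by rewrite -[leLHS]sqrtr1 ler_sqrt//; lra.
    rewrite [X in _ * X]ger0_norm ?invr_ge0 ?sqrtr_ge0//.
    rewrite ler_pdivrMr; last by lra.
    have t0 := sqr_ge0 t.
    apply: (@le_trans _ _ (t ^+ 2 + 1)); last by rewrite ler_peMr//; lra.
    by rewrite ler_norml; apply/andP; split; lra.
rewrite ge0_integralD//; last 2 first.
- by move=> t _; rewrite lee_fin sqr_ge0.
- exact: measurable_EFin_sqr.
by rewrite std_moment2 integral_cst_prob -EFinD ltry.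
Qed.

Lemma hermite_coefE n (K : set 'rV[R]_n) (S : 'I_n -> nat) : cvx K ->
  (forall i, S i = 0%N \/ S i = 2%N) ->
  ((hermite_coef (set_sign K) S)%:E =
   \int[gauss n]_x (set_sign (clo K) x * hermiteS S x)%:E)%E.
Proof.
move=> cK S02.
have := gauss_expect_sign n K 1 (fun i => hermite (S i)) cK
  (fun i => measurable_hermite02 _ (S02 i)) (fun i => integral_hermite02_lty _ (S02 i)).
under [X in (gauss_expect X)%:E]eq_fun do rewrite mul1r.
by move=> ->; apply: eq_integral => x _; rewrite /signed mul1r.
Qed.

Lemma integral_set_sign n (C : set 'rV[R]_n) (q : 'rV[R]_n -> R) : measurable C ->
  (gauss n).-integrable setT (EFin \o q) ->
  (\int[gauss n]_x (set_sign C x * q x)%:E =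
   2%:E * \int[gauss n]_(x in C) (q x)%:E - \int[gauss n]_x (q x)%:E)%E.
Proof.
move=> mC iq; have iqC := integrableS measurableT mC (@subsetT _ C) iq.
have iqr : (gauss n).-integrable setT ((EFin \o q) \_ C).
  by move: iqC; rewrite (integrable_mkcond _ mC).
rewrite [X in (2%:E * X)%E]integral_mkcond -integralZl//.
rewrite -integralB//; last exact: integrableZl.
apply: eq_integral => x _; rewrite patchE set_signE indicE.
by case: ifP => _; rewrite ?mule0 -?EFinM -?EFinB; congr EFin => /=; ring.
Qed.

Lemma hermite_coef0 n (K : set 'rV[R]_n) (S : 'I_n -> nat) : cvx K ->
  (forall i, S i = 0%N) ->
  hermite_coef (set_sign K) S = 2 * pr (gauss n) (clo K) - 1.
Proof.
move=> cK S0; apply: EFin_inj; rewrite hermite_coefE//; last by move=> i; left.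
have h1 (x : 'rV[R]_n) : hermiteS S x = 1.
  by rewrite /hermiteS big1// => i _; rewrite S0 hermite0.
under eq_integral do rewrite h1.
have mC := measurable_clo _ K.
rewrite (integral_set_sign n (clo K) (cst 1))//=; last first.
  by apply: finite_measure_integrable_cst.
by rewrite integral_cst// mul1e integral_cst_prob [X in (_ * X)%E](prE (gauss n) (clo K) mC).
Qed.

Definition coord2 {n} (C : set 'rV[R]_n) (i : 'I_n) : R :=
  fine (\int[gauss n]_(x in C) ((x ord0 i : R) ^+ 2)%:E)%E.

Lemma integrable_coord2 n (i : 'I_n) :
  (gauss n).-integrable setT (fun x : 'rV[R]_n => (x ord0 i ^+ 2)%:E).
Proof.
apply/integrableP; split.
  by apply/measurable_EFinP; apply: measurable_funX; exact: measurable_coord.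
under eq_integral do rewrite gee0_abs ?lee_fin ?sqr_ge0//.
by rewrite gauss_moment2 ltry.
Qed.

Lemma coord2E n (C : set 'rV[R]_n) i : measurable C ->
  (\int[gauss n]_(x in C) ((x ord0 i : R) ^+ 2)%:E = (coord2 C i)%:E)%E.
Proof.
move=> mC; rewrite fineK//; apply: integrable_fin_num => //.
exact: integrableS measurableT mC (@subsetT _ C) (integrable_coord2 n i).
Qed.

Lemma sum_coord2 n (C : set 'rV[R]_n) : measurable C -> \sum_i coord2 C i = mass2 C.
Proof.
move=> mC; apply: EFin_inj; rewrite -sumEFin -mass2E//.
transitivity (\sum_(i < n) \int[gauss n]_(x in C) ((x ord0 i : R) ^+ 2)%:E)%E.
  by apply: eq_bigr => i _; rewrite coord2E.
rewrite -ge0_integral_sum//.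
- by apply: eq_integral => x _; rewrite sumEFin.
- move=> i; apply: measurable_funTS; apply/measurable_EFinP.
  by apply: measurable_funX; exact: measurable_coord.
- by move=> i x _; rewrite lee_fin sqr_ge0.
Qed.

Lemma integral_hermite2_coord n (C : set 'rV[R]_n) i : measurable C ->
  (\int[gauss n]_(x in C) (hermite 2%N (x ord0 i : R))%:E =
   ((coord2 C i - pr (gauss n) C) / Num.sqrt 2)%:E)%E.
Proof.
move=> mC.
have i2 := integrableS measurableT mC (@subsetT _ C) (integrable_coord2 n i).
have i1 : (gauss n).-integrable C (fun=> (1 : R)%:E).
  exact: finite_measure_integrable_cst.
rewrite (eq_integral (fun x : 'rV[R]_n =>
   ((Num.sqrt 2)^-1)%:E * ((x ord0 i ^+ 2)%:E - 1))%E); last first.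
  by move=> x _; rewrite hermite2 -EFinB -EFinM mulrC.
rewrite integralZl//; last exact: integrableB.
rewrite integralB// coord2E// integral_cst// mul1e [X in (_ - X)%E](prE (gauss n) C mC).
by rewrite -EFinB -EFinM mulrC.
Qed.

Lemma hermite_coef2 n (K : set 'rV[R]_n) (S : 'I_n -> nat) i : cvx K ->
  S i = 2%N -> (forall j, j != i -> S j = 0%N) ->
  hermite_coef (set_sign K) S =
    Num.sqrt 2 * (coord2 (clo K) i - pr (gauss n) (clo K)).
Proof.
move=> cK Si Sj; apply: EFin_inj; rewrite hermite_coefE//; last first.
  by move=> j; have [->|ji] := eqVneq j i; [right|left; exact: Sj].
have h2 (x : 'rV[R]_n) : hermiteS S x = hermite 2%N (x ord0 i).
  by rewrite /hermiteS (bigD1 i)//= big1 ?mulr1 ?Si// => j ji; rewrite Sj// hermite0.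
under eq_integral do rewrite h2.
have mC := measurable_clo _ K.
rewrite (integral_set_sign n (clo K) (fun x => hermite 2%N (x ord0 i)))//; last first.
  rewrite (_ : EFin \o _ = (fun x : 'rV[R]_n =>
     ((Num.sqrt 2)^-1)%:E * ((x ord0 i ^+ 2)%:E - 1))%E); last first.
    by apply/funext => x /=; rewrite hermite2 -EFinB -EFinM mulrC.
  apply: integrableZl => //; apply: integrableB => //; first exact: integrable_coord2.
  exact: finite_measure_integrable_cst.
rewrite !integral_hermite2_coord//.
(* Over the whole space [h_2] integrates to 0, so only the part on the closure remains, with factor
   [2 / sqrt 2 = sqrt 2]. *)
have -> : coord2 setT i = 1 by rewrite /coord2 gauss_moment2.
have -> : pr (@gauss R n) setT = 1 by apply: EFin_inj; rewrite -prE//; exact: probability_setT.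
rewrite subrr mul0r sube0 -EFinM; congr EFin.
have s0 : 0 < Num.sqrt 2 :> R by rewrite sqrtr_gt0.
have s2 : Num.sqrt 2 * Num.sqrt 2 = 2 :> R by rewrite -expr2 sqr_sqrtr.
rewrite -[X in X * _ = _]s2; move: (Num.sqrt 2) s0 => s s0 /=.
by field; rewrite gt_eqF.
Qed.

(** Cauchy-Schwarz against the constant vector, read off from the nonnegative sum of the
    [(n a_i - s)^2]. *)
Lemma sqr_sum_le n (a : 'I_n -> R) : (\sum_i a i) ^+ 2 <= n%:R * \sum_i a i ^+ 2.
Proof.
have [n0|n0] := posnP n.
  by subst n; rewrite !big_ord0 expr0n mulr0.
set s := \sum_i a i.
have : 0 <= \sum_i (n%:R * a i - s) ^+ 2 by apply: sumr_ge0 => i _; exact: sqr_ge0.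
have -> : \sum_i (n%:R * a i - s) ^+ 2 = n%:R * (n%:R * (\sum_i a i ^+ 2) - s ^+ 2).
  transitivity (\sum_i (n%:R ^+ 2 * a i ^+ 2 + (- (2 * n%:R * s) * a i + s ^+ 2))).
    by apply: eq_bigr => i _; ring.
  by rewrite !big_split/= -!mulr_sumr -/s sumr_const card_ord -mulr_natl; ring.
by rewrite pmulr_rge0 ?ltr0n// subr_ge0.
Qed.

Lemma weight_eq0 n (K : set 'rV[R]_n) : cvx K ->
  weight_eq (set_sign K) 0 = (2 * pr (gauss n) (clo K) - 1) ^+ 2.
Proof.
move=> cK; rewrite /weight_eq (big_pred1 [ffun=> ord0]).
  by rewrite hermite_coef0// => i; rewrite ffunE.
move=> S /=; rewrite big1; last by move=> i _; rewrite ord1.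
by rewrite eqxx; apply/esym/eqP/ffunP => i; rewrite ffunE ord1.
Qed.

(** The mixed indices [e_i + e_j] contribute nonnegative squares and are dropped. *)
Lemma weight_eq2_ge n (K : set 'rV[R]_n) : cvx K ->
  \sum_(i < n) 2 * (coord2 (clo K) i - pr (gauss n) (clo K)) ^+ 2 <=
  weight_eq (set_sign K) 2.
Proof.
move=> cK.
(* Here [ord_max] in ['I_3] is 2, so [e i] encodes the multi-index [2 e_i]. *)
pose e (i : 'I_n) : {ffun 'I_n -> 'I_3} := [ffun j => if j == i then ord_max else ord0].
have e_inj : injective e.
  move=> i j /ffunP/(_ i); rewrite !ffunE eqxx.
  by case: eqVneq => // _ /(congr1 val).
have coefE i : hermite_coef (set_sign K) (fun j => e i j : nat) ^+ 2 =
    2 * (coord2 (clo K) i - pr (gauss n) (clo K)) ^+ 2.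
  rewrite (hermite_coef2 n K _ i)//; first by rewrite exprMn sqr_sqrtr.
    by rewrite ffunE eqxx.
  by move=> j /negPf ji; rewrite ffunE ji.
under eq_bigr do rewrite -coefE.
rewrite /weight_eq (bigID (fun S => S \in [set e i | i : 'I_n]))/=.
rewrite [X in _ <= X + _](eq_bigl (fun S => S \in [set e i | i : 'I_n])); last first.
  move=> S; apply: andb_idl => /imsetP[i _ ->].
  rewrite (bigD1 i)//= ffunE eqxx big1 ?addn0// => j /negPf ji.
  by rewrite ffunE ji.
rewrite big_imset/=; last by move=> i j _ _; exact: e_inj.
by rewrite lerDl sumr_ge0// => S _; exact: sqr_ge0.
Qed.

End coefficients.

Theorem theorem1p6 (R : realType) :
  exists c : R, 0 < c /\
    forall (n : nat) (K : set 'rV[R]_n),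
      convex_set K -> centrally_symmetric K ->
      c / n%:R <= weight_eq (set_sign K) 0 + weight_eq (set_sign K) 2.
Proof.
pose m : R := 3 / (25 * weight_bound R).
have wb : 3 <= weight_bound R by rewrite /weight_bound; lra.
have m0 : 0 < m by rewrite divr_gt0// mulr_gt0//; lra.
have m1 : m <= 1 / 25.
  rewrite ler_pdivrMr; last by rewrite mulr_gt0//; lra.
  lra.
exists (2 * m ^+ 2); split; first by rewrite mulr_gt0// exprn_gt0.
move=> n K /convex_set_cvx cK sK.
have W2 := weight_eq2_ge n K cK; rewrite weight_eq0//.
set C := clo K in W2 *.
have W20 : 0 <= weight_eq (set_sign K) 2 by apply: sumr_ge0 => S _; exact: sqr_ge0.
have [n0|n0] := posnP n.
  (* In dimension 0 the quotient by [n] is 0 by convention. *)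
  by have -> : n%:R = 0 :> R by [rewrite n0]; rewrite invr0 mulr0 addr_ge0// sqr_ge0.
have nr : 1 <= n%:R :> R by rewrite ler1n.
have [far|near] := boolP ((pr (gauss n) C < 2 / 5) || (3 / 5 < pr (gauss n) C)).
  (* Off [[2/5, 3/5]] the degree-0 weight alone is at least [(1/5)^2], which exceeds [2 m^2] because
     [m <= 1/25]. *)
  have W0 : 1 / 25 <= (2 * pr (gauss n) C - 1) ^+ 2 by case/orP: far; nra.
  apply: (@le_trans _ _ (1 / 25)); last by lra.
  rewrite ler_pdivrMr; last by lra.
  by nra.
move: near; rewrite negb_or -!leNgt => /andP[glo ghi].
have cC : cvx C by exact: clo_cvx.
have sC : forall x, C x -> C (- x) by apply: clo_sym => x; exact: (sK x).1.
have C0 : C 0.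
  (* The measure is at least [2/5], so [C] has a point [x], and the origin is the midpoint of [x]
     and [-x]. *)
  have [x Cx] : C !=set0.
    apply/set0P/eqP => C_0; move: glo; rewrite C_0 /pr measure0/=; lra.
  have -> : 0 = (1 / 2) *: x + (1 / 2) *: (- x) :> 'rV[R]_n.
    by rewrite scalerN subrr.
  by apply: cC => //; [exact: sC|lra].
have mC : measurable C by exact: measurable_clo.
have lb := growth_rate_lower C mC cC sC C0 glo ghi; rewrite -/m in lb.
apply: (@le_trans _ _ (weight_eq (set_sign K) 2)); last by rewrite lerDr sqr_ge0.
apply: le_trans W2.
rewrite -mulr_sumr ler_pdivrMr; last by lra.
rewrite -mulrA ler_pM2l// mulrC.
apply: le_trans (sqr_sum_le n _).
rewrite big_split/= sumr_const card_ord sum_coord2// -mulr_natl.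
have -> : (mass2 C + n%:R * - pr (gauss n) C) ^+ 2 =
   (n%:R * pr (gauss n) C - mass2 C) ^+ 2 by ring.
by rewrite lerXn2r// nnegrE; [exact: ltW|exact: le_trans (ltW m0) lb].
Qed.
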